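(* Let $\mathcal{A}$ be a unital $C^*$-algebra (the algebra of observables), let $\pi$ be a (unital $*$-)representation of $\mathcal{A}$ by bounded operators on a Hilbert space $\mathcal{H}$, and let $S$ be the (nonempty) set of states of the representation, each $\omega\in S$ being given by a density matrix $\rho_\omega$ on $\mathcal{H}$, $\omega(D)=\mathrm{Tr}(\rho_\omega D)$. Assume that the experimental principle holds: for every observable $D$ of the representation, in the enlarged sense defined in the context, $\inf_{\omega\in S}\Delta_\omega(D)=0$. If $A=A^*$, $B=B^*\in\mathcal{A}$ are such that the observables $\pi(A),\pi(B)$ are complementary, i.e. there is a constant $C>0$ with $$\Delta_\omega(\pi(A))+\Delta_\omega(\pi(B))\geq C\qquad\text{for all }\omega\in S,$$ then the $C^*$-algebra $\mathcal{A}(A,B)$ generated by $\pi(A)$, $\pi(B)$ (and the identity) is not commutative.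
   Context: For a self-adjoint bounded operator $D$ on $\mathcal{H}$ and a state $\omega$, $\Delta_\omega(D)\geq 0$ is defined by $\Delta_\omega(D)^2=\omega\big((D-\omega(D)\mathbf{1})^2\big)$. Observables of the representation (enlarged sense): all self-adjoint operators $D\in\mathcal{B}(\mathcal{H})$ which belong to the weak operator closure $\overline{\mathcal{B}}^{\,w}$ (the von Neumann algebra generated by $\mathcal{B}$) of some Abelian unital $C^*$-subalgebra $\mathcal{B}\subset\pi(\mathcal{A})$. In particular self-adjoint elements of $\pi(\mathcal{A})$ are observables. Experimental principle: for any given observable one can prepare states for which a sharp value is approximated as well as one likes, i.e. for each observable $D$ one has $\inf_{\omega\in S}\Delta_\omega(D)=0$. The set $S$ is not assumed to consist of all density-matrix states. *)

(* Defs.v *)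
From HB Require Import structures.
From mathcomp Require Import all_boot all_order all_algebra finmap complex.
From mathcomp Require Import boolp classical_sets functions reals.
From mathcomp Require Import topology normedtype.

Set Implicit Arguments.
Unset Strict Implicit.
Unset Printing Implicit Defensive.

Import Order.TTheory GRing.Theory Num.Theory.

Local Open Scope classical_set_scope.
Local Open Scope ring_scope.

(* As in the library, norms over a field K are K-valued, so the norms and radii
   below are elements of the complex field; 0 <= z says there that z is real
   and nonnegative. *)

(* The library has no join of its ring and normed-module hierarchies over a
   fixed field, so the norm of a C*-algebra is a field of the structure.
   algType imposes 1 != 0. *)
HB.mixin Record isCStarAlgebra (K : numClosedFieldType) A
    & GRing.Algebra K A := {
  cnorm : A -> K;
  cnormD : forall a b : A, cnorm (a + b) <= cnorm a + cnorm b;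
  cnormZ : forall (k : K) (a : A), cnorm (k *: a) = `|k| * cnorm a;
  cnorm0_eq0 : forall a : A, cnorm a = 0 -> a = 0;
  cnormM : forall a b : A, cnorm (a * b) <= cnorm a * cnorm b;
  cnorm_complete : forall u : nat -> A,
    (forall e : K, 0 < e -> exists N, forall m n : nat,
       (N <= m)%N -> (N <= n)%N -> cnorm (u m - u n) < e) ->
    exists l : A, forall e : K, 0 < e -> exists N, forall n : nat,
       (N <= n)%N -> cnorm (u n - l) < e;
  star : A -> A;
  starD : forall a b : A, star (a + b) = star a + star b;
  starZ : forall (k : K) (a : A), star (k *: a) = k^* *: star a;
  starM : forall a b : A, star (a * b) = star b * star a;
  starK : forall a : A, star (star a) = a;
  cstar_identity : forall a : A, cnorm (star a * a) = cnorm a ^+ 2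
}.

#[short(type="cstarAlgType")]
HB.structure Definition CStarAlgebra (K : numClosedFieldType) :=
  { A of GRing.Algebra K A & isCStarAlgebra K A }.

(* The inner product is linear in its first argument and conjugate-linear in
   the second. *)
HB.mixin Record isHilbert (K : numClosedFieldType) H
    & CompleteNormedModule K H := {
  inner : {dot H for @Num.conj K};
  inner_norm : forall x : H, inner x x = `|x| ^+ 2
}.

#[short(type="hilbertType")]
HB.structure Definition Hilbert (K : numClosedFieldType) :=
  { H of CompleteNormedModule K H & isHilbert K H }.

Section Operators.
Context {K : numClosedFieldType} {H : hilbertType K}.
Implicit Types (T U : H -> H) (B : set (H -> H)).

Local Notation "'[ x , y ]" := (@inner K H x y) : ring_scope.

Definition opnorm_le T (M : K) : Prop := forall x, `|T x| <= M * `|x|.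

Definition bounded_op T : Prop := linear T /\ exists M, opnorm_le T M.

Definition is_adjoint T U : Prop := forall x y, '[T x, y] = '[x, U y].

Definition self_adjoint T : Prop := is_adjoint T T.

Definition norm_closed B : Prop :=
  forall T, bounded_op T ->
    (forall e : K, 0 < e -> exists2 U, B U & opnorm_le (T - U) e) -> B T.

(* Unital C*-subalgebras of B(H), with the identity operator as unit. *)
Record cstar_subalgebra B : Prop := {
  cstar_subalgebra_bounded : B `<=` bounded_op;
  cstar_subalgebra_id : B idfun;
  cstar_subalgebraD : forall T U, B T -> B U -> B (T + U);
  cstar_subalgebraZ : forall (k : K) T, B T -> B (k *: T);
  cstar_subalgebraM : forall T U, B T -> B U -> B (T \o U);
  cstar_subalgebra_adj : forall T U, B T -> is_adjoint T U -> B U;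
  cstar_subalgebra_closed : norm_closed B
}.

Definition commutative_ops B : Prop :=
  forall T U, B T -> B U -> T \o U = U \o T.

(* The unital C*-algebra generated by G: the intersection of all unital
   C*-subalgebras of B(H) containing G. *)
Definition cstar_generated (G : set (H -> H)) : set (H -> H) :=
  smallest cstar_subalgebra G.

Definition wo_closure B : set (H -> H) :=
  [set D | forall (s : seq (H * H)) (e : K), 0 < e ->
     exists2 T, B T & forall p, p \in s -> `|'[D p.1, p.2] - '[T p.1, p.2]| < e].

Definition orthonormal_basis (E : set H) : Prop :=
  (forall x y, E x -> E y -> '[x, y] = (x == y)%:R) /\
  (forall x, (forall y, E y -> '[x, y] = 0) -> x = 0).

(* Unordered summation: convergence along the finite subsets of E. *)
Definition has_sum (I : choiceType) (E : set I) (f : I -> K) (s : K) : Prop :=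
  forall e : K, 0 < e ->
    exists2 F0 : {fset I}, [set` F0] `<=` E &
      forall F : {fset I}, (F0 `<=` F)%fset -> [set` F] `<=` E ->
        `|\sum_(i <- F) f i - s| < e.

(* The trace does not depend on the orthonormal basis, and H is not assumed to
   be separable. *)
Definition has_trace T (t : K) : Prop :=
  forall E, orthonormal_basis E -> has_sum E (fun x => '[T x, x]) t.

Definition density_matrix (rho : H -> H) : Prop :=
  [/\ bounded_op rho, forall x, 0 <= '[rho x, x] & has_trace rho 1].

(* Only the values of omega on bounded operators are meaningful. *)
Definition density_state (omega : (H -> H) -> K) : Prop :=
  exists2 rho, density_matrix rho &
    forall D, bounded_op D -> has_trace (rho \o D) (omega D).

End Operators.

Section Representations.
Context {K : numClosedFieldType} {A : cstarAlgType K} {H : hilbertType K}.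
Implicit Types (pi : A -> H -> H) (D : H -> H).

Record representation pi : Prop := {
  representation_bounded : forall a, bounded_op (pi a);
  representationD : forall a b, pi (a + b) = pi a + pi b;
  representationZ : forall (k : K) a, pi (k *: a) = k *: pi a;
  representationM : forall a b, pi (a * b) = pi a \o pi b;
  representation1 : pi 1 = idfun;
  representation_star : forall a, is_adjoint (pi a) (pi (star a))
}.

Definition observable pi D : Prop :=
  [/\ bounded_op D, self_adjoint D &
    exists B, [/\ cstar_subalgebra B, commutative_ops B,
                  B `<=` range pi & wo_closure B D]].

End Representations.

Section Uncertainty.
Context {R : realType} {H : hilbertType R[i]}.
Implicit Types (D E : H -> H) (omega : (H -> H) -> R[i])
  (S : set ((H -> H) -> R[i])).

(* For a density state omega and a self-adjoint bounded operator D, the value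
   of omega under the root is real and nonnegative. *)
Definition Delta omega D : R :=
  let D0 := D - omega D *: idfun in Num.sqrt (complex.Re (omega (D0 \o D0))).

Definition complementary S D E : Prop :=
  exists2 C : R, 0 < C & forall omega, S omega -> C <= Delta omega D + Delta omega E.

Definition experimental_principle (A : cstarAlgType R[i]) (pi : A -> H -> H) S
  : Prop :=
  forall D, observable pi D -> inf [set Delta omega D | omega in S] = 0.

End Uncertainty.

(* Main.v *)
Require Import Defs.
From mathcomp Require Import all_boot all_order all_algebra finmap complex.
From mathcomp Require Import boolp classical_sets functions reals.
From mathcomp Require Import topology normedtype.
From mathcomp Require Import sequences ring lra.

(** If the C*-algebra B generated by pi(A), pi(B) were commutative, its weak
    closure would contain the sign of each of its self-adjoint elements, so
    pi(A) could be approximated in norm by sums of e_i / 2^i, where each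
    self-adjoint e_i satisfies e_i^3 = e_i.  As the spectrum of such an e lies in
    {-1, 0, 1}, both e and a contraction T can be read off e + T / 4; iterating,
    a single observable D encodes pi(B) and an approximation of pi(A), and a
    state in which D is nearly sharp makes pi(A) and pi(B) nearly sharp,
    contradicting complementarity.

    That B lies in the range of pi uses that this range is norm closed: the
    element x / (1 + x^2), computed from the Cayley transform, lifts a small
    self-adjoint pi(x) to an element of controlled norm up to a much smaller error.

    That a density state omega is positive uses that the trace does not depend on
    the basis: if U = c + i d is unitary, with c, d self-adjoint and commuting,
    summing over the bases U E and U^* E gives
    omega(c^2) = sum_e <rho (c e), c e>. *)

Set Implicit Arguments.
Unset Strict Implicit.
Unset Printing Implicit Defensive.

Import Order.TTheory GRing.Theory Num.Theory.
Import numFieldNormedType.Exports.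

Local Open Scope classical_set_scope.
Local Open Scope ring_scope.
Local Open Scope complex_scope.

(** The experimental principle speaks of one observable at a time, and [S] need not contain any
    state built by hand: the only sharp states are those that the principle supplies, so [pi a] and
    [pi b] must both be estimated through one observable. Two commuting self-adjoint elements are in
    general not continuous functions of a third one, since their joint spectrum may be a square,
    which does not embed in a line. The weak closure admits discontinuous functions, and the sign is
    the only one used. The control constant grows with the number of digits encoded. That number is
    therefore fixed first, from the complementarity constant [C], and the state is chosen
    afterwards. No spectral measure occurs: every estimate compares norms of vectors. Transferring
    such estimates to omega needs positivity, which is not visible term by term, because <rho (Q x),
    x> may fail to be nonnegative for a positive Q. Changing the basis by a unitary and by its
    inverse stands in for the cyclicity of the trace, and operator square roots serve to build that
    unitary. *)

Section ComplexFacts.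
Context {R : realType}.

Lemma normc_real (r : R) : `|r%:C : R[i]| = `|r|%:C.
Proof. by rewrite normc_def /= expr0n addr0 sqrtr_sqr. Qed.

Lemma normc_i : `|'i : R[i]| = 1.
Proof. by rewrite normc_def /= expr0n expr1n add0r sqrtr1. Qed.

Lemma Re_norm_i : complex.Re `|'i : R[i]| = 1.
Proof. by rewrite normc_i. Qed.

Lemma conjR (r : R) : Num.conj r%:C = r%:C.
Proof. exact: conjc_real. Qed.

Lemma half_half : (2^-1)%:C + (2^-1)%:C = 1 :> R[i].
Proof. by rewrite -rmorphD -[2^-1]mul1r -splitr rmorph1. Qed.

Lemma norm_half : `|2^-1 : R| = 2^-1.
Proof. by rewrite ger0_norm ?invr_ge0. Qed.

End ComplexFacts.

(** * The underlying real Hilbert space *)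

Section RealHilbert.
Context {R : realType} {H : hilbertType R[i]}.
Implicit Types (x y z : H) (T U : H -> H).

(** Real-valued versions of the norm and of the inner product, so that estimates live in an ordered
    field where [lra] and [nra] work. *)
Definition nrm x : R := complex.Re `|x|.
Definition rip x y : R := complex.Re (inner x y).

Lemma nrmE x : `|x| = (nrm x)%:C.
Proof.
rewrite /nrm; have := normr_ge0 x; rewrite lecE => /andP[/eqP /= h _].
by case: (`|x|) h => a b /= ->.
Qed.

Lemma nrm_ge0 x : 0 <= nrm x.
Proof. by rewrite -ler0c -nrmE. Qed.

Lemma nrmD x y : nrm (x + y) <= nrm x + nrm y.
Proof. by rewrite -lecR rmorphD /= -!nrmE ler_normD. Qed.

Lemma nrmZ (r : R) x : nrm (r%:C *: x) = `|r| * nrm x.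
Proof.
by apply: complexI; rewrite rmorphM /= -!nrmE normrZ normc_real.
Qed.

Lemma nrmN x : nrm (- x) = nrm x.
Proof. by rewrite /nrm normrN. Qed.

Lemma nrmBC x y : nrm (x - y) = nrm (y - x).
Proof. by rewrite -nrmN opprB. Qed.

Lemma nrmB x y : nrm (x - y) <= nrm x + nrm y.
Proof. by rewrite -(nrmN y) nrmD. Qed.

Lemma nrm0 : nrm 0 = 0.
Proof. by rewrite /nrm normr0. Qed.

Lemma nrm0_eq0 x : nrm x = 0 -> x = 0.
Proof. by move=> h; apply/eqP; rewrite -normr_eq0 nrmE h. Qed.

Lemma rip_nrm x : rip x x = nrm x ^+ 2.
Proof. by rewrite /rip inner_norm nrmE -rmorphXn. Qed.

Lemma innerC x y : inner x y = (inner y x)^*.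
Proof. by rewrite hermC expr0 mul1r. Qed.

Lemma ripC x y : rip x y = rip y x.
Proof. by rewrite /rip innerC; case: (inner y x). Qed.

Lemma ripDl x y z : rip (x + y) z = rip x z + rip y z.
Proof. by rewrite /rip linearDl raddfD. Qed.

Lemma ripNl x z : rip (- x) z = - rip x z.
Proof. by rewrite /rip linearNl raddfN. Qed.

Lemma ripBl x y z : rip (x - y) z = rip x z - rip y z.
Proof. by rewrite ripDl ripNl. Qed.

Lemma ripZl (r : R) x z : rip (r%:C *: x) z = r * rip x z.
Proof. by rewrite /rip linearZl_LR /=; case: (inner x z) => a b /=; ring. Qed.

Lemma ripDr x y z : rip z (x + y) = rip z x + rip z y.
Proof. by rewrite !(ripC z) ripDl. Qed.

Lemma ripNr x z : rip z (- x) = - rip z x.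
Proof. by rewrite !(ripC z) ripNl. Qed.

Lemma ripBr x y z : rip z (x - y) = rip z x - rip z y.
Proof. by rewrite ripDr ripNr. Qed.

Lemma ripZr (r : R) x z : rip z (r%:C *: x) = r * rip z x.
Proof. by rewrite !(ripC z) ripZl. Qed.

Lemma rip0l z : rip 0 z = 0.
Proof. by rewrite /rip linear0l. Qed.

Lemma rip_ge0 x : 0 <= rip x x.
Proof. by rewrite rip_nrm sqr_ge0. Qed.

Lemma Cauchy_Schwarz x y : `|rip x y| <= nrm x * nrm y.
Proof.
have key u v : rip u v <= nrm u * nrm v.
  have [->|/eqP v0] := eqVneq v 0; first by rewrite ripC rip0l nrm0 mulr0.
  have [->|/eqP u0] := eqVneq u 0; first by rewrite rip0l nrm0 mul0r.
  (* This vector expands to 2 |u| |v| (|u| |v| - <u, v>) without any division. *)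
  have := rip_ge0 ((nrm v)%:C *: u - (nrm u)%:C *: v).
  rewrite ripBl !ripBr !ripZl !ripZr !rip_nrm (ripC v u).
  have := nrm_ge0 u; have := nrm_ge0 v.
  have nz w : w <> 0 -> nrm w != 0 by move=> h; apply/eqP => /nrm0_eq0.
  move: (nz _ u0) (nz _ v0) => un vn.
  rewrite !le0r (negPf un) (negPf vn) /= => vp up h.
  have {}h : 0 <= 2 * (nrm u * nrm v) * (nrm u * nrm v - rip u v) by nra.
  rewrite pmulr_rge0 in h; last by rewrite !mulr_gt0.
  by rewrite -subr_ge0.
by rewrite ler_norml key andbT -lerN2 opprK -ripNl -(nrmN x) key.
Qed.

(** Serves throughout to turn an identity between vectors into one between real numbers, which
    [ring], [field] or [lra] settles. *)
Lemma rip_eq x y : (forall z, rip x z = rip y z) -> x = y.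
Proof.
move=> h; apply/eqP; rewrite -subr_eq0; apply/eqP/nrm0_eq0/eqP.
by rewrite -sqrf_eq0 -rip_nrm ripBl h subrr.
Qed.

Definition scvg (u : nat -> H) (l : H) :=
  forall e : R, 0 < e -> exists N, forall n, (N <= n)%N -> nrm (u n - l) < e.

Lemma scvg_unique u l l' : scvg u l -> scvg u l' -> l = l'.
Proof.
move=> h h'; apply/eqP; rewrite -subr_eq0; apply/eqP/nrm0_eq0/eqP.
rewrite eq_le nrm_ge0 andbT; apply/ler_addgt0Pl => e e0; rewrite addr0.
have e2 : 0 < e / 2 by rewrite divr_gt0.
have [N hN] := h _ e2; have [N' hN'] := h' _ e2.
have := hN _ (leq_maxl N N'); have := hN' _ (leq_maxr N N').
set w := u _ => a b.
have -> : l - l' = (w - l') - (w - l) by rewrite opprB [RHS]addrC subrKA.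
by apply: le_trans (nrmB _ _) _; lra.
Qed.

Lemma complete u :
  (forall e : R, 0 < e -> exists N, forall m n, (N <= m)%N -> (N <= n)%N ->
     nrm (u m - u n) < e) -> exists l, scvg u l.
Proof.
move=> hu; have : cvg (u @ \oo).
  apply/cauchy_cvgP/cauchyP => e e0.
  have [N hN] := hu (complex.Re e) (ltac:(by move: e0; rewrite ltcE => /andP[])).
  exists (u N); exists N => // n /= Nn; rewrite -ball_normE /= nrmE.
  by rewrite ltcE /=; move: e0; rewrite ltcE => /andP[/= /eqP <- _]; rewrite eqxx hN.
move=> /cvg_ex[/= l /cvgrPdist_lt hl]; exists l => e e0.
have [N _ hN] := hl e%:C (ltac:(by rewrite ltcR)).
by exists N => n Nn; rewrite -ltcR nrmBC -nrmE; exact: hN.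
Qed.

End RealHilbert.

Lemma nondecreasing_bounded_cauchy (R : realType) (t : nat -> R) (M : R) :
  (forall m n, (m <= n)%N -> t m <= t n) -> (forall n, t n <= M) ->
  forall e, 0 < e -> exists N, forall m n, (N <= m)%N -> (m <= n)%N ->
    t n - t m < e.
Proof.
move=> ht hM e e0.
have hs : has_sup (range t).
  by split; [exists (t 0%N), 0%N | exists M => _ [n _ <-]].
have [_ [N _ <-] hN] := sup_adherent e0 hs; exists N => m n Nm mn.
have := ht _ _ Nm; have := sup_upper_bound hs (imageT t n); rewrite /= => a b.
lra.
Qed.

Lemma exp_small (R : realType) (C r e : R) : 0 <= r -> r < 1 -> 0 < e ->
  exists N, forall n, (N <= n)%N -> C * r ^+ n < e.
Proof.
move=> r0 r1 e0; have C1 : 0 < `|C| + 1 by rewrite ltr_wpDl.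
have /cvgrPdist_lt/(_ (e / (`|C| + 1)))[] : (GRing.exp r) @ \oo --> (0 : R).
  by apply: cvg_expr; rewrite ger0_norm.
  by rewrite divr_gt0.
move=> N _ hN; exists N => n /hN /=; rewrite sub0r normrN ltr_pdivlMr //.
have rn : 0 <= r ^+ n by rewrite exprn_ge0.
by rewrite ger0_norm // => h; have := ler_norm C; nra.
Qed.

(** * The sign of a self-adjoint contraction *)

Section Operators.
Context {R : realType} {H : hilbertType R[i]}.
Implicit Types (x y z : H) (s w T U : H -> H).

Lemma linear_D T : linear T -> forall x y, T (x + y) = T x + T y.
Proof. by move=> h x y; rewrite -{1}[x]scale1r h scale1r. Qed.

Lemma linear_0 T : linear T -> T 0 = 0.
Proof. by move=> h; apply: (addIr (T 0)); rewrite add0r -linear_D // add0r. Qed.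

Lemma linear_Z T : linear T -> forall k x, T (k *: x) = k *: T x.
Proof. by move=> h k x; rewrite -[k *: x]addr0 h linear_0 // addr0. Qed.

Lemma linear_N T : linear T -> forall x, T (- x) = - T x.
Proof. by move=> h x; rewrite -scaleN1r linear_Z // scaleN1r. Qed.

Lemma linear_B T : linear T -> forall x y, T (x - y) = T x - T y.
Proof. by move=> h x y; rewrite linear_D // linear_N. Qed.

Lemma self_adjoint_rip T : self_adjoint T -> forall x y, rip (T x) y = rip x (T y).
Proof. by move=> h x y; rewrite /rip h. Qed.

Definition nonexpansive T := forall x, nrm (T x) <= nrm x.

Lemma scvg_nrm_le (u : nat -> H) (l : H) (c : R) :
  scvg u l -> (forall n, nrm (u n) <= c) -> nrm l <= c.
Proof.
move=> hu hc; apply/ler_addgt0Pl => e e0; have [N hN] := hu _ e0.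
have := nrmB (u N) (u N - l); rewrite subKr.
by have := hN _ (leqnn N); have := hc N; lra.
Qed.

Lemma scvg_bounded T (c : R) (u : nat -> H) l : linear T ->
  (forall x, nrm (T x) <= c * nrm x) -> scvg u l -> scvg (fun n => T (u n)) (T l).
Proof.
move=> hT hc hu e e0.
have c1 : 0 < `|c| + 1 by rewrite ltr_wpDl.
have [N hN] := hu (e / (`|c| + 1)) (divr_gt0 e0 c1); exists N => n /hN.
rewrite -linear_B // ltr_pdivlMr // => h; apply: le_lt_trans (hc _) _.
by have := ler_norm c; have := nrm_ge0 (u n - l); nra.
Qed.

(** * Polynomials in a positive symmetric operator *)

Definition nneg_poly (p : {poly R}) := forall i, 0 <= p`_i.

Lemma nneg_polyD p q : nneg_poly p -> nneg_poly q -> nneg_poly (p + q).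
Proof. by move=> hp hq i; rewrite coefD addr_ge0. Qed.

Lemma nneg_polyM p q : nneg_poly p -> nneg_poly q -> nneg_poly (p * q).
Proof. by move=> hp hq i; rewrite coefM sumr_ge0 // => j _; rewrite mulr_ge0. Qed.

Lemma nneg_polyC c : 0 <= c -> nneg_poly c%:P.
Proof. by move=> c0 i; rewrite coefC; case: ifP. Qed.

Section PolynomialCalculus.
Variable w : H -> H.
Implicit Types p q : {poly R}.

Definition ev p x := \sum_(i < size p) (p`_i)%:C *: iter i w x.

Lemma ev_wide n p x : (size p <= n)%N -> ev p x = \sum_(i < n) (p`_i)%:C *: iter i w x.
Proof.
move=> h; rewrite /ev (big_ord_widen _ (fun i => (p`_i)%:C *: iter i w x) h).
rewrite big_mkcond; apply: eq_bigr => i _; case: ltnP => // /leq_sizeP -> //.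
by rewrite scale0r.
Qed.

Lemma evD p q x : ev (p + q) x = ev p x + ev q x.
Proof.
have h := size_polyD p q.
rewrite (ev_wide _ h) (ev_wide _ (leq_maxl (size p) (size q))).
rewrite (ev_wide _ (leq_maxr (size p) (size q))) -big_split /=.
by apply: eq_bigr => i _; rewrite coefD rmorphD /= scalerDl.
Qed.

Lemma evC (c : R) x : ev c%:P x = c%:C *: x.
Proof. by rewrite (ev_wide _ (size_polyC_leq1 c)) big_ord1 coefC. Qed.

Lemma evMX p x : ev (p * 'X) x = ev p (w x).
Proof.
have h : (size (p * 'X)%R <= (size p).+1)%N.
  by apply: leq_trans (size_polyMleq _ _) _; rewrite size_polyX addn2.
rewrite (ev_wide _ h) big_ord_recl coefMX scale0r add0r /ev.
by apply: eq_bigr => i _; rewrite coefMX -iterSr.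
Qed.

Lemma evX x : ev 'X x = w x.
Proof. by rewrite -['X]mul1r evMX evC scale1r. Qed.

Hypothesis wlin : linear w.

Lemma ev_linear p : linear (ev p).
Proof.
elim/poly_ind: p => [|p c h] k x y; first by rewrite !evC !scale0r scaler0 addr0.
by rewrite !evD !evMX !evC wlin h !scalerDr !scalerA (mulrC k) addrACA.
Qed.

Lemma evW p x : ev p (w x) = w (ev p x).
Proof.
elim/poly_ind: p x => [|p c h] x; first by rewrite !evC !scale0r (linear_0 wlin).
by rewrite !evD !evMX !evC h (linear_D wlin) (linear_Z wlin).
Qed.

Lemma evCM c q x : ev (c%:P * q) x = c%:C *: ev q x.
Proof.
elim/poly_ind: q x => [|q d h] x; first by rewrite mulr0 -polyC0 !evC scale0r scaler0.
by rewrite mulrDr mulrA -polyCM !evD !evMX h !evC scalerDr scalerA rmorphM.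
Qed.

Lemma evM p q x : ev (p * q) x = ev p (ev q x).
Proof.
elim/poly_ind: p x => [|p c h] x; first by rewrite mul0r !evC !scale0r.
by rewrite mulrDl !evD evCM evC -mulrA [_ * q]mulrC mulrA !evMX h evW.
Qed.

Hypothesis wsym : forall x y, rip (w x) y = rip x (w y).

Lemma ev_sym p x y : rip (ev p x) y = rip x (ev p y).
Proof.
elim/poly_ind: p x y => [|p c h] x y.
  by rewrite -polyC0 !evC !scale0r rip0l ripC rip0l.
by rewrite !evD !evMX !evC ripDl ripDr h wsym -evW ripZl ripZr.
Qed.

Hypothesis wpos : forall x, 0 <= rip (w x) x.

(** Powers of [w] are positive: the form of w^(i+2) at y is the form of w^i at w y, so the even
    powers reduce to the identity and the odd ones to [w]. *)
Lemma ev_ge0 p x : nneg_poly p -> 0 <= rip (ev p x) x.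
Proof.
move=> hp.
have hi i : (forall y, 0 <= rip (iter i w y) y) /\ (forall y, 0 <= rip (iter i.+1 w y) y).
  elim: i => [|i [h1 h2]]; first by split=> y; [exact: rip_ge0 | exact: wpos].
  by split=> // y; rewrite iterS wsym iterSr; exact: h1.
rewrite /ev; apply: (big_ind (fun z => 0 <= rip z x)).
- by rewrite rip0l.
- by move=> y z hy hz; rewrite ripDl addr_ge0.
- by move=> i _; rewrite ripZl mulr_ge0 ?(hi i).1.
Qed.

End PolynomialCalculus.

(** What the construction uses of the self-adjoint part of a commutative von Neumann algebra.
    Commutativity makes products self-adjoint, and sequential strong limits of contractions are the
    only limits taken. *)
Record real_algebra (M : set (H -> H)) : Prop := {
  ra_linear : forall T, M T -> linear T;
  ra_sa : forall T, M T -> self_adjoint T;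
  ra_id : M idfun;
  ra_D : forall T U, M T -> M U -> M (fun x => T x + U x);
  ra_Z : forall (r : R) T, M T -> M (fun x => r%:C *: T x);
  ra_M : forall T U, M T -> M U -> M (fun x => T (U x));
  ra_comm : forall T U x, M T -> M U -> T (U x) = U (T x);
  ra_lim : forall (T : nat -> H -> H) U, (forall n, M (T n)) ->
    (forall n, nonexpansive (T n)) -> (forall x, scvg (T ^~ x) (U x)) -> M U
}.

Section SpectralSign.
Variables (M : set (H -> H)) (hM : real_algebra M).

Lemma ra_B T U : M T -> M U -> M (fun x => T x - U x).
Proof.
move=> hT hU; have := ra_D hM hT (ra_Z hM (-1) hU).
by under [X in M X -> _]eq_fun => x do rewrite rmorphN1 scaleN1r.
Qed.

Lemma ra_ev w p : M w -> M (ev w p).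
Proof.
move=> hw; elim/poly_ind: p => [|p c h].
  have := ra_Z hM 0 (ra_id hM); congr M; apply/funext => x.
  by rewrite evC.
have := ra_D hM (ra_M hM h hw) (ra_Z hM c (ra_id hM)); congr M.
by apply/funext => x; rewrite evD evMX evC.
Qed.

Variable s : H -> H.
Hypotheses (sM : M s) (s1 : nonexpansive s).

Let w x := x - s (s x).

Let wM : M w. Proof. exact: (ra_B (ra_id hM) (ra_M hM sM sM)). Qed.
Let slin := ra_linear hM sM.
Let wlin := ra_linear hM wM.
Let ssym := self_adjoint_rip (ra_sa hM sM).
Let wsym := self_adjoint_rip (ra_sa hM wM).

Let wpos x : 0 <= rip (w x) x.
Proof.
rewrite /w ripBl ssym !rip_nrm subr_ge0.
by rewrite ler_pXn2r ?nnegrE ?nrm_ge0.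
Qed.

Let h : {poly R} := (2^-1)%:P.
(* The iterates s_n of s |-> (3 s - s^3) / 2 converge to the sign of s.  They are
   s_n = s G_n(w) with w = 1 - s^2, and W_n(w) = 1 - s_n^2 satisfies
   W_(n+1) = W_n^2 (3 + W_n) / 4, so that all these polynomials have nonnegative
   coefficients and hence positive values at w. *)
Fixpoint sign_factor n : {poly R} :=
  if n is n.+1 then let g := sign_factor n in
    g * (1 + h * (1 - (1 - 'X) * g ^+ 2))
  else 1.
Local Notation G := sign_factor.
Let W n : {poly R} := 1 - (1 - 'X) * G n ^+ 2.

Let hh : h + h = 1.
Proof. by rewrite /h -polyCD -[2^-1]mul1r -splitr. Qed.

Let W_S n : W n.+1 = h ^+ 2 * (3 * W n ^+ 2 + W n ^+ 3).
Proof.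
rewrite /W /=; set g := G n; set v := 1 - (1 - 'X) * g ^+ 2.
have -> : (1 - 'X) * (g * (1 + h * v)) ^+ 2 = (1 - v) * (1 + h * v) ^+ 2.
  by rewrite /v; ring.
have -> : (1 + h * v) ^+ 2 = 1 + (h + h) * v + h ^+ 2 * v ^+ 2 by ring.
(* [ring] treats [h] as a free symbol. Writing 3 h^2 as (h + h)^2 - h^2 lets [hh] supply the only
   fact about [h] that the identity rests on. *)
have <- : (h + h) ^+ 2 * v ^+ 2 - h ^+ 2 * v ^+ 2 + h ^+ 2 * v ^+ 3 =
    h ^+ 2 * (3 * v ^+ 2 + v ^+ 3) by ring.
by rewrite hh; ring.
Qed.

Let h_ge0 : nneg_poly h.
Proof. by apply: nneg_polyC; rewrite invr_ge0. Qed.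

Let W_ge0 n : nneg_poly (W n).
Proof.
elim: n => [|n IH].
  by rewrite /W /= expr1n mulr1 subKr => i; rewrite coefX ler0n.
rewrite W_S !exprS expr0 !mulr1; apply: nneg_polyM; first exact: nneg_polyM.
apply: nneg_polyD; last by do 2?[apply: nneg_polyM].
by apply: nneg_polyM; [rewrite -polyC_natr; apply: nneg_polyC | apply: nneg_polyM].
Qed.

Let G_S n : G n.+1 = G n + G n * (h * W n).
Proof. by rewrite /= /W; ring. Qed.

Let G_ge0 n : nneg_poly (G n).
Proof.
elim: n => [|n IH]; first by rewrite /= -polyC1; exact: nneg_polyC.
by rewrite G_S; apply: nneg_polyD => //; do 2?[apply: nneg_polyM].
Qed.

Let G_nd m n : (m <= n)%N -> nneg_poly (G n - G m).
Proof.
have z k : nneg_poly (G k - G k) by rewrite subrr -polyC0; exact: nneg_polyC.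
elim: n => [|n IH]; first by rewrite leqn0 => /eqP ->.
rewrite leq_eqVlt => /predU1P[->|/IH IHn]; first exact: z.
by rewrite G_S addrAC; apply: nneg_polyD => //; do 2?[apply: nneg_polyM].
Qed.

Let a n x := s (ev w (G n) x).

Let aM n : M (a n). Proof. exact: (ra_M hM sM (ra_ev _ wM)). Qed.

Let evB p q x : ev w (p - q) x = ev w p x - ev w q x.
Proof. by rewrite evD -mulN1r -polyCN evCM rmorphN1 scaleN1r. Qed.

Let ev1 x : ev w 1 x = x. Proof. by rewrite evC scale1r. Qed.

(* This makes ||s_n x - s_m x||^2 at most ||s_n x||^2 - ||s_m x||^2, whence
   strong convergence. *)
Let a_nd m n x : (m <= n)%N -> 0 <= rip (a m x) (a n x - a m x).
Proof.
move=> mn; have e p : s (ev w p x) = ev w p (s x) by exact: ra_comm (ra_ev _ wM).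
have -> : a n x - a m x = ev w (G n - G m) (s x) by rewrite evB /a !e.
rewrite /a e ripC -ev_sym // -evM //; apply: ev_ge0 => //.
by apply: nneg_polyM => //; exact: G_nd.
Qed.

Let ss y : s (s y) = ev w (1 - 'X) y.
Proof. by rewrite evB ev1 evX /w subKr. Qed.

Let evWa n x : ev w (W n) x = x - a n (a n x).
Proof.
rewrite /a (ra_comm hM _ (ra_ev _ wM) sM) ss evB ev1 -!evM //; congr (_ - ev w _ x).
by rewrite -mulrA expr2.
Qed.

Let a_sqr n x : rip (a n x) (a n x) = nrm x ^+ 2 - rip (ev w (W n) x) x.
Proof.
have asym := self_adjoint_rip (ra_sa hM (aM n)).
by rewrite evWa ripBl -rip_nrm subKr -asym.
Qed.

Let a_le n : nonexpansive (a n).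
Proof.
move=> x; rewrite -(@ler_pXn2r _ 2) ?nnegrE ?nrm_ge0 // -!rip_nrm a_sqr rip_nrm.
by rewrite gerDl oppr_le0 ev_ge0.
Qed.

Let a0 x : a 0 x = s x. Proof. by rewrite /a ev1. Qed.

Let a_S n x : a n.+1 x - a n x = (2^-1)%:C *: (a n x - a n (a n (a n x))).
Proof.
have alin := ra_linear hM (aM n).
rewrite -(linear_B alin) -evWa -(linear_Z alin) /a G_S evD (linear_D slin) addrC addKr.
by rewrite evM // evCM.
Qed.

Let a_cauchy x e : 0 < e -> exists N, forall m n, (N <= m)%N -> (N <= n)%N ->
  nrm (a m x - a n x) < e.
Proof.
move=> e0; have inc m n : (m <= n)%N ->
    nrm (a n x - a m x) ^+ 2 <= nrm (a n x) ^+ 2 - nrm (a m x) ^+ 2.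
  move=> /(a_nd x); rewrite -!rip_nrm ripBl !ripBr (ripC (a m x) (a n x)); lra.
have [||N hN] := @nondecreasing_bounded_cauchy R (fun n => nrm (a n x) ^+ 2)
    (nrm x ^+ 2) _ _ _ (exprn_gt0 2 e0).
- by move=> m n /inc; have := sqr_ge0 (nrm (a n x - a m x)); lra.
- by move=> n; rewrite ler_pXn2r ?nnegrE ?nrm_ge0 //; exact: a_le.
exists N; have hlt m n : (N <= m)%N -> (m <= n)%N -> nrm (a n x - a m x) < e.
  move=> Nm mn; rewrite -(@ltr_pXn2r _ 2) ?nnegrE ?nrm_ge0 ?(ltW e0) //.
  exact: le_lt_trans (inc _ _ mn) (hN _ _ Nm mn).
move=> m n Nm Nn; case/orP: (leq_total m n) => mn; last exact: hlt.
by rewrite nrmBC; exact: hlt.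
Qed.

(** The last clause extracts a binary digit: on the spectrum of [s], contained in [-1, 1], the
    function 2 t - sgn t has modulus at most 1, so the remainder is again a contraction. *)
Lemma spectral_sign : exists e, [/\ M e, nonexpansive e,
  (forall x, e (e (e x)) = e x) & forall x, nrm (2%:C *: s x - e x) <= nrm x].
Proof.
have /choice[e he] x : exists l, scvg (a ^~ x) l by apply: complete; exact: a_cauchy.
have eM : M e by exact: ra_lim aM a_le he.
have e1 : nonexpansive e by move=> x; exact: scvg_nrm_le (he x) (fun n => a_le n x).
exists e; split=> // x.
- have alin n := ra_linear hM (aM n).
  apply: (@scvg_unique _ _ (fun n => a n (a n (a n x)))) => d d0.
    have d3 : 0 < d / 3 by lra.
    have [N1 h1] := he x _ d3; have [N2 h2] := he (e x) _ d3.
    have [N3 h3] := he (e (e x)) _ d3.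
    exists (maxn N1 (maxn N2 N3)) => n; rewrite !geq_max => /and3P[/h1 {}h1 /h2 {}h2 /h3 {}h3].
    have -> : a n (a n (a n x)) - e (e (e x)) =
      a n (a n (a n x - e x)) + a n (a n (e x) - e (e x)) + (a n (e (e x)) - e (e (e x))).
      by rewrite !(linear_B (alin n)) !subrKA.
    have t1 := le_trans (a_le n _) (a_le n (a n x - e x)).
    have t2 := a_le n (a n (e x) - e (e x)).
    apply: le_lt_trans (nrmD _ _) _; apply: le_lt_trans (lerD (nrmD _ _) (lexx _)) _; lra.
  have d5 : 0 < d / 5 by lra.
  have [N hN] := he x _ d5; exists N => n Nn.
  have h1 := hN _ Nn; have h2 := hN _ (leq_trans Nn (leqnSn n)).
  (* The iteration read backwards, s_n^3 = 3 s_n - 2 s_(n+1), shows that s_n^3 x also tends to e x;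
     3 + 2 explains d / 5. *)
  have -> : a n (a n (a n x)) - e x = 3%:C *: (a n x - e x) - 2%:C *: (a n.+1 x - e x).
    have := a_S n x; set u := a n.+1 x; set u' := a n (a n (a n x)) => aS.
    apply: rip_eq => z; have := congr1 (rip^~ z) aS.
    rewrite /= !(ripBl, ripZl); lra.
  apply: le_lt_trans (nrmB _ _) _; rewrite !nrmZ !ger0_norm //; lra.
have hex := he x; apply: (@scvg_nrm_le (fun n => 2%:C *: s x - a n x)).
  move=> d d0; have [N hN] := hex _ d0; exists N => n /hN; rewrite nrmBC.
  by congr (nrm _ < _); rewrite [RHS]addrC opprB subrKA.
(* |2 s x - s_n x|^2 equals |s_n x|^2 - 4 <s x, s_n x - s x>. Since s_0 = s, [a_nd] makes the
   subtracted term nonnegative, and s_n is a contraction. *)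
move=> n; rewrite -(@ler_pXn2r _ 2) ?nnegrE ?nrm_ge0 //.
have := @a_nd 0 n x isT; have := a_sqr n x; rewrite !a0 -!rip_nrm.
have := @ev_ge0 w wsym wpos (W n) x (W_ge0 n).
rewrite !(ripBl, ripBr, ripZl, ripZr) (ripC (a n x) (s x)); lra.
Qed.

End SpectralSign.
End Operators.

(** * Encoding several observables in one *)

Section Control.
Context {R : realType} {H : hilbertType R[i]}.
Implicit Types (x y z : H) (D E T U e : H -> H).

(* If D is nearly sharp at the value d, then T is nearly sharp at the value t. *)
Definition controls D T := exists2 c : R, 0 <= c &
  forall d : R, exists t : R, forall x,
    nrm (T x - t%:C *: x) <= c * nrm (D x - d%:C *: x).

Lemma controls_refl D : controls D D.
Proof. by exists 1 => // d; exists d => x; rewrite mul1r. Qed.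

Lemma controls_trans E D T : controls D E -> controls E T -> controls D T.
Proof.
move=> [c c0 h] [c' c'0 h']; exists (c' * c); first exact: mulr_ge0.
move=> d; have [t ht] := h d; have [u hu] := h' t; exists u => x.
by apply: le_trans (hu x) _; rewrite -mulrA ler_wpM2l.
Qed.

Lemma controls_comb D T U (a b : R) : controls D T -> controls D U ->
  controls D (fun x => a%:C *: T x + b%:C *: U x).
Proof.
move=> [c c0 h] [c' c'0 h']; exists (`|a| * c + `|b| * c').
  by rewrite addr_ge0 // mulr_ge0.
move=> d; have [t ht] := h d; have [u hu] := h' d; exists (a * t + b * u) => x.
have -> : a%:C *: T x + b%:C *: U x - (a * t + b * u)%:C *: x =
    a%:C *: (T x - t%:C *: x) + b%:C *: (U x - u%:C *: x).
  by apply: rip_eq => z; rewrite !(ripDl, ripNl, ripZl); ring.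
apply: le_trans (nrmD _ _) _; rewrite !nrmZ mulrDl -!mulrA.
by rewrite lerD // ler_wpM2l.
Qed.

(** * Adding one digit to an encoding *)

Section Step.
Variables (M : set (H -> H)) (hM : real_algebra M) (e T : H -> H).
Hypotheses (eM : M e) (TM : M T) (e1 : nonexpansive e) (T1 : nonexpansive T).
Hypothesis e3 : forall x, e (e (e x)) = e x.

Let D x := e x + (4^-1)%:C *: T x.
Let elin := ra_linear hM eM.
Let DM : M D. Proof. exact: (ra_D hM eM (ra_Z hM _ TM)). Qed.

(** [P] plays the role of the spectral projection of [e] at [j]. It commutes with [D], so P (D - d)
    = (j - d) P + T P / 4, whose value at x has norm at least (1/2 - 1/4) |P x|. With the crude
    bound 2 for [P] this gives the constant 2 * 4 = 8. *)
Let component_le P (j d : R) x : M P -> (forall x, nrm (P x) <= 2 * nrm x) ->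
  (forall x, e (P x) = j%:C *: P x) -> 1 / 2 <= `|j - d| ->
  nrm (P x) <= 8 * nrm (D x - d%:C *: x).
Proof.
move=> PM P2 eP jd; have Plin := ra_linear hM PM.
have h : P (D x - d%:C *: x) = (j - d)%:C *: P x + (4^-1)%:C *: T (P x).
  rewrite (linear_B Plin) (linear_Z Plin) (ra_comm hM _ PM DM) /D eP.
  by apply: rip_eq => z; rewrite !(ripDl, ripNl, ripZl); ring.
have := P2 (D x - d%:C *: x); rewrite h => h2.
have := nrmB ((j - d)%:C *: P x + (4^-1)%:C *: T (P x)) ((4^-1)%:C *: T (P x)).
have q4 : `|4^-1 : R| = 4^-1 by rewrite ger0_norm ?invr_ge0.
rewrite addrK !nrmZ q4 => h3.
have := T1 (P x); have := nrm_ge0 (P x); nra.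
Qed.

(** For j = 1 and j = -1, and with e^3 = e, these are the spectral projections of [e] at [j]; [p0]
    is the one at 0. *)
Let pe (j : R) x := (2^-1)%:C *: (e (e x) + j%:C *: e x).
Let p0 x := x - e (e x).

Let peM j : M (pe j).
Proof. exact: (ra_Z hM _ (ra_D hM (ra_M hM eM eM) (ra_Z hM j eM))). Qed.

Let p0M : M p0. Proof. exact: (ra_B hM (ra_id hM) (ra_M hM eM eM)). Qed.

Let pe_le j x : `|j| <= 1 -> nrm (pe j x) <= 2 * nrm x.
Proof.
move=> j1; rewrite /pe nrmZ ger0_norm ?invr_ge0 //.
have := nrmD (e (e x)) (j%:C *: e x); rewrite nrmZ.
have := e1 (e x); have := e1 x; have := nrm_ge0 (e x); nra.
Qed.

Let p0_le x : nrm (p0 x) <= 2 * nrm x.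
Proof. by have := nrmB x (e (e x)); have := e1 (e x); have := e1 x; rewrite /p0; lra. Qed.

Let e_pe j x : j * j = 1 -> e (pe j x) = j%:C *: pe j x.
Proof.
move=> jj; rewrite /pe (linear_Z elin) (linear_D elin) (linear_Z elin) e3.
by apply: rip_eq => z; rewrite !(ripDl, ripNl, ripZl); ring: jj.
Qed.

Let e_p0 x : e (p0 x) = 0%:C *: p0 x.
Proof. by rewrite /p0 (linear_B elin) e3 subrr scale0r. Qed.

(* The spectral components of e for -1, 0, 1 reduce D, and on each of them D is
   within 1/4 of that number, so d is far from at least two of the three. *)
Lemma controls_sign : controls D e.
Proof.
(* 24 = 8 + 2 * 8: for j = 1 or -1, e - j combines the other two components with coefficients of
   modulus 1 and 2. For j = 0 both coefficients have modulus 1. *)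
exists 24 => // d; set N := fun x => nrm (D x - d%:C *: x).
have k0 x : 1 / 2 <= `|0 - d| -> nrm (p0 x) <= 8 * N x by exact: component_le.
have k1 x : 1 / 2 <= `|1 - d| -> nrm (pe 1 x) <= 8 * N x.
  by apply: component_le => // y; [apply: pe_le; rewrite normr1 | apply: e_pe; rewrite mulr1].
have kN x : 1 / 2 <= `|- 1 - d| -> nrm (pe (-1) x) <= 8 * N x.
  apply: component_le => // y; first by apply: pe_le; rewrite normrN1.
  by apply: e_pe; rewrite mulrNN mulr1.
have E x : e x = pe 1 x - pe (-1) x.
  by apply: rip_eq => z; rewrite !(ripDl, ripNl, ripZl); lra.
have I x : x = pe 1 x + p0 x + pe (-1) x.
  by apply: rip_eq => z; rewrite !(ripDl, ripNl, ripZl); lra.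
have [d1|d1] := leP (1 / 2) d.
  exists 1 => x; have -> : e x - 1%:C *: x = - p0 x - 2%:C *: pe (-1) x.
    apply: rip_eq => z; have := congr1 (rip^~ z) (E x); have := congr1 (rip^~ z) (I x).
    by rewrite /= !(ripDl, ripNl, ripZl); lra.
  apply: le_trans (nrmB _ _) _; rewrite nrmN nrmZ (@ger0_norm _ 2) //.
  have := k0 x; have := kN x; rewrite !ler0_norm; [|lra|lra] => h h'.
  have := h (ltac:(lra)); have := h' (ltac:(lra)); rewrite /N; lra.
have [d2|d2] := leP d (- (1 / 2)).
  exists (-1) => x; have -> : e x - (-1)%:C *: x = 2%:C *: pe 1 x + p0 x.
    apply: rip_eq => z; have := congr1 (rip^~ z) (E x); have := congr1 (rip^~ z) (I x).
    by rewrite /= !(ripDl, ripNl, ripZl); lra.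
  apply: le_trans (nrmD _ _) _; rewrite nrmZ (@ger0_norm _ 2) //.
  have := k0 x; have := k1 x; rewrite !ger0_norm; [|lra|lra] => h h'.
  have := h (ltac:(lra)); have := h' (ltac:(lra)); rewrite /N; lra.
exists 0 => x; rewrite scale0r subr0 E; apply: le_trans (nrmB _ _) _.
have := k1 x; have := kN x; rewrite ler0_norm ?ger0_norm; [|lra|lra] => h h'.
have := h (ltac:(lra)); have := h' (ltac:(lra)).
have := nrm_ge0 (D x - d%:C *: x); rewrite /N; lra.
Qed.

Lemma controls_rest : controls D T.
Proof.
have := controls_comb 4 (-4) (controls_refl D) controls_sign.
congr controls; apply/funext => x.
by apply: rip_eq => z; rewrite /D !(ripDl, ripNl, ripZl); field.
Qed.

End Step.

Variables (M : set (H -> H)) (hM : real_algebra M).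

(** Recursion on binary digits: a = e / 2 + (2 a - e) / 2 with [e] the sign of [a], and the
    remainder 2 a - e is encoded first. So [b] lies innermost in [D], under the successive digits of
    [a]. *)
Lemma controlled_approximation k a b : M a -> M b -> nonexpansive a -> nonexpansive b ->
  exists D a', [/\ M D, nonexpansive D, controls D b, controls D a' &
    forall x, nrm (a x - a' x) <= 2^-1 ^+ k * nrm x].
Proof.
move=> aM bM a1 b1; elim: k a aM a1 => [|k IH] a aM a1.
  exists b, (fun x => 0); split=> //; first exact: controls_refl.
    have := controls_comb 0 0 (controls_refl b) (controls_refl b).
    by congr controls; apply/funext => x; rewrite !scale0r addr0.
  by move=> x; rewrite subr0 expr0 mul1r.
have [e [eM e1 e3 ae]] := spectral_sign hM aM a1.
have a'M : M (fun x => 2%:C *: a x - e x) by exact: (ra_B hM (ra_Z hM _ aM) eM).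
have [D0 [a0 [D0M D01 D0b D0a h]]] := IH _ a'M ae.
pose D1 x := e x + (4^-1)%:C *: D0 x.
have D1M : M D1 by exact: (ra_D hM eM (ra_Z hM _ D0M)).
(* e + D0 / 4 has norm at most 5/4; the factor 1/2 makes it a contraction again, as the next stage
   of the recursion requires. *)
pose D x := (2^-1)%:C *: D1 x.
have D1D : controls D D1.
  have := controls_comb 2 0 (controls_refl D) (controls_refl D).
  by congr controls; apply/funext => x; apply: rip_eq => z; rewrite !(ripDl, ripZl); lra.
have De : controls D e by apply: controls_trans D1D _; exact: (controls_sign hM eM D0M e1 D01 e3).
have DD0 : controls D D0 by apply: controls_trans D1D _; exact: (controls_rest hM eM D0M e1 D01 e3).
exists D, (fun x => (2^-1)%:C *: e x + (2^-1)%:C *: a0 x); split.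
- exact: ra_Z.
- move=> x; rewrite /D nrmZ ger0_norm ?invr_ge0 //; have := nrmD (e x) ((4^-1)%:C *: D0 x).
  rewrite nrmZ ger0_norm ?invr_ge0 //; have := e1 x; have := D01 x.
  by have := nrm_ge0 x; rewrite -/(D1 x); lra.
- exact: controls_trans DD0 D0b.
- exact: controls_comb De (controls_trans DD0 D0a).
- move=> x; have -> : a x - ((2^-1)%:C *: e x + (2^-1)%:C *: a0 x) =
    (2^-1)%:C *: (2%:C *: a x - e x - a0 x).
    by apply: rip_eq => z; rewrite !(ripDl, ripNl, ripZl); field.
  by rewrite nrmZ ger0_norm ?invr_ge0 // exprS -mulrA ler_pM2l ?invr_gt0.
Qed.

Lemma joint_control a b (L eps : R) : M a -> M b ->
  (forall x, nrm (a x) <= L * nrm x) -> (forall x, nrm (b x) <= L * nrm x) ->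
  0 < eps ->
  exists D, [/\ M D, nonexpansive D & exists2 c : R, 0 <= c & forall d : R,
    (exists t : R, forall x, nrm (a x - t%:C *: x) <= c * nrm (D x - d%:C *: x) + eps * nrm x) /\
    (exists t : R, forall x, nrm (b x - t%:C *: x) <= c * nrm (D x - d%:C *: x) + eps * nrm x)].
Proof.
move=> aM bM aL bL e0; pose l := `|L| + 1; have l0 : 0 < l by rewrite ltr_wpDl.
have Ll : L <= l by have := ler_norm L; rewrite /l; lra.
have sc T : M T -> (forall x, nrm (T x) <= L * nrm x) ->
    M (fun x => (l^-1)%:C *: T x) /\ nonexpansive (fun x => (l^-1)%:C *: T x).
  move=> TM TL; split; first exact: ra_Z.
  move=> x; rewrite nrmZ ger0_norm ?invr_ge0 ?(ltW l0) // ler_pdivrMl //.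
  by apply: le_trans (TL x) _; rewrite ler_wpM2r ?nrm_ge0.
have [[a1M a1] [b1M b1]] := (sc a aM aL, sc b bM bL).
(* Undoing the scaling by [l] turns the error 2^-k on [a] into l 2^-k. *)
have [k hk] := @exp_small R l 2^-1 _ (ltac:(lra)) (ltac:(lra)) e0.
have [D [a' [DM D1 [c c0 hb] [c' c'0 ha] haa]]] := controlled_approximation k a1M b1M a1 b1.
exists D; split=> //; exists (l * (c + c')); first by rewrite mulr_ge0 ?addr_ge0 ?(ltW l0).
move=> d; have [t ht] := ha d; have [u hu] := hb d; split.
  exists (l * t) => x.
  have -> : a x - (l * t)%:C *: x =
     l%:C *: (((l^-1)%:C *: a x - a' x) + (a' x - t%:C *: x)).
    by apply: rip_eq => z; rewrite !(ripDl, ripNl, ripZl); field; rewrite gt_eqF.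
  rewrite nrmZ ger0_norm ?(ltW l0) //; have := nrmD ((l^-1)%:C *: a x - a' x) (a' x - t%:C *: x).
  have := ht x; have := haa x; have := hk k (leqnn k).
  set P := 2^-1 ^+ k; set n0 := nrm (D x - _); set n1 := nrm ((l^-1)%:C *: a x - a' x + _).
  have : 0 <= n0 by exact: nrm_ge0.
  have := nrm_ge0 x; move=> x0 n00 h1 h2 h3 h4.
  have h5 : l * n1 <= l * (P * nrm x + c' * n0) by rewrite ler_pM2l //; lra.
  have h6 : l * P * nrm x <= eps * nrm x by rewrite ler_wpM2r // ltW.
  have h7 : 0 <= l * c * n0 by rewrite !mulr_ge0 // ltW.
  lra.
exists (l * u) => x.
have -> : b x - (l * u)%:C *: x = l%:C *: ((l^-1)%:C *: b x - u%:C *: x).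
  by apply: rip_eq => z; rewrite !(ripDl, ripNl, ripZl); field; rewrite gt_eqF.
rewrite nrmZ ger0_norm ?(ltW l0) //; have := hu x.
set n0 := nrm (D x - _) => h.
have h5 : l * nrm ((l^-1)%:C *: b x - u%:C *: x) <= l * (c * n0) by rewrite ler_pM2l.
have h7 : 0 <= l * c' * n0 by rewrite !mulr_ge0 ?nrm_ge0 // ltW.
have := mulr_ge0 (ltW e0) (nrm_ge0 x); lra.
Qed.

End Control.

(** * Weak closure of a commutative algebra of operators *)

Section BoundedOperators.
Context {R : realType} {H : hilbertType R[i]}.
Implicit Types (x : H) (T U : H -> H).

Lemma nrm_scale (k : R[i]) x : nrm (k *: x) = complex.Re `|k| * nrm x.
Proof.
rewrite {1}/nrm normrZ nrmE; have : 0 <= `|k| by [].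
by rewrite lecE => /andP[/eqP /= k0 _]; case: `|k| k0 => p q /= ->; rewrite mul0r subr0.
Qed.

Lemma bounded_op_real T (c : R) : linear T -> (forall x, nrm (T x) <= c * nrm x) ->
  bounded_op T.
Proof. by move=> lT h; split=> //; exists c%:C => x; rewrite !nrmE -rmorphM lecR. Qed.

Lemma bounded_opE T : bounded_op T ->
  linear T /\ exists2 c : R, 0 <= c & forall x, nrm (T x) <= c * nrm x.
Proof.
move=> [lT [c hc]]; split=> //; exists `|complex.Re c| => // x.
have := hc x; rewrite !nrmE lecE => /andP[_].
case: c hc => p q _ /=; rewrite mulr0 subr0 => h; apply: le_trans h _.
by rewrite ler_wpM2r ?nrm_ge0 // ler_norm.
Qed.

Lemma bounded_opD T U : bounded_op T -> bounded_op U -> bounded_op (fun x => T x + U x).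
Proof.
move=> /bounded_opE[lT [c c0 hc]] /bounded_opE[lU [d d0 hd]].
apply: (@bounded_op_real _ (c + d)).
  by move=> k x y; rewrite lT lU scalerDr addrACA.
by move=> x; apply: le_trans (nrmD _ _) _; rewrite mulrDl lerD.
Qed.

Lemma bounded_opZ (k : R[i]) T : bounded_op T -> bounded_op (fun x => k *: T x).
Proof.
move=> /bounded_opE[lT [c c0 hc]]; apply: (@bounded_op_real _ (complex.Re `|k| * c)).
  by move=> a x y; rewrite lT scalerDr !scalerA mulrC.
move=> x; rewrite nrm_scale -mulrA ler_wpM2l //.
by have := normr_ge0 k; rewrite lecE => /andP[].
Qed.

Lemma bounded_opM T U : bounded_op T -> bounded_op U -> bounded_op (fun x => T (U x)).
Proof.
move=> /bounded_opE[lT [c c0 hc]] /bounded_opE[lU [d d0 hd]].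
apply: (@bounded_op_real _ (c * d)); first by move=> k x y; rewrite lU lT.
by move=> x; apply: le_trans (hc _) _; rewrite -mulrA ler_wpM2l.
Qed.

Lemma bounded_op_id : bounded_op (@idfun H).
Proof. by apply: (@bounded_op_real _ 1) => // x; rewrite mul1r. Qed.

Lemma bounded_opB T U : bounded_op T -> bounded_op U -> bounded_op (fun x => T x - U x).
Proof.
move=> hT /(bounded_opZ (-1)) hU; have := bounded_opD hT hU.
by congr bounded_op; apply/funext => x; rewrite scaleN1r.
Qed.

Lemma self_adjointB (r : R) T : self_adjoint T -> self_adjoint (fun x => T x - r%:C *: x).
Proof.
by move=> sT x y; rewrite linearBl linearBr /= linearZl_LR linearZr_LR /= sT conjR.
Qed.

End BoundedOperators.

(** * The self-adjoint part of the weak closure *)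

Section WeakClosure.
Context {R : realType} {H : hilbertType R[i]}.
Implicit Types (x y z : H) (T U V : H -> H).

Lemma Im_inner x y : complex.Im (inner x y) = rip x ('i *: y).
Proof.
by rewrite /rip linearZr_LR /=; case: (inner x y) => p q /=; ring.
Qed.

Lemma inner_eq x y x' y' : (forall k : R[i], rip x (k *: y) = rip x' (k *: y')) ->
  inner x y = inner x' y'.
Proof.
move=> h; apply/eqP; rewrite eq_complex !Im_inner h eqxx andbT.
by have := h 1; rewrite !scale1r /rip => ->.
Qed.

Lemma innerE x y : inner x y = (rip x y)%:C + 'i * (rip x ('i *: y))%:C.
Proof. by rewrite -Im_inner /rip -complexE. Qed.

Lemma rip_self_adjoint T : linear T -> (forall x y, rip (T x) y = rip x (T y)) ->
  self_adjoint T.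
Proof. by move=> lT h x y; apply: inner_eq => k; rewrite h (linear_Z lT). Qed.

Lemma inner_le x y : `|inner x y| <= (2 * (nrm x * nrm y))%:C.
Proof.
rewrite innerE; apply: le_trans (ler_normD _ _) _.
have -> : (2 * (nrm x * nrm y))%:C = (nrm x * nrm y)%:C + (nrm x * nrm y)%:C.
  by rewrite -rmorphD; congr (_%:C); ring.
rewrite normrM normc_i mul1r !normc_real lerD // lecR; apply: le_trans (Cauchy_Schwarz _ _) _ => //.
by rewrite nrm_scale Re_norm_i mul1r.
Qed.

Lemma inner_sep x y : (forall z, inner x z = inner y z) -> x = y.
Proof. by move=> h; apply: rip_eq => z; rewrite /rip h. Qed.

Lemma inner_approx (k l : R[i]) : (forall e, 0 < e -> `|k - l| < e) -> k = l.
Proof.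
move=> h; apply/eqP; rewrite -subr_eq0 -normr_eq0; apply/negP => /negP n0.
by have := h `|k - l|; rewrite ltxx lt_def n0 normr_ge0 => /(_ isT).
Qed.

Lemma scvgD (u v : nat -> H) l m : scvg u l -> scvg v m ->
  scvg (fun n => u n + v n) (l + m).
Proof.
move=> hu hv e e0; have e2 : 0 < e / 2 by lra.
have [N hN] := hu _ e2; have [N' hN'] := hv _ e2; exists (maxn N N') => n.
rewrite geq_max => /andP[/hN h /hN' h']; rewrite opprD addrACA.
by apply: le_lt_trans (nrmD _ _) _; lra.
Qed.

Lemma scvgZ (k : R[i]) (u : nat -> H) l : scvg u l -> scvg (fun n => k *: u n) (k *: l).
Proof.
apply: (@scvg_bounded _ _ (fun x => k *: x) (complex.Re `|k|)).
  by move=> a x y; rewrite scalerDr !scalerA mulrC.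
by move=> x; rewrite nrm_scale.
Qed.

Lemma scvg_linear (T : nat -> H -> H) U : (forall n, linear (T n)) ->
  (forall x, scvg (T ^~ x) (U x)) -> linear U.
Proof.
move=> lT h k x y; have := scvgD (scvgZ k (h x)) (h y).
apply: scvg_unique => e e0; have [N hN] := h (k *: x + y) e e0.
by exists N => n /hN; rewrite lT.
Qed.

Lemma scvg_self_adjoint (T : nat -> H -> H) U : (forall n, linear (T n)) ->
  (forall n, self_adjoint (T n)) -> (forall x, scvg (T ^~ x) (U x)) -> self_adjoint U.
Proof.
move=> lT sT h; have lU := scvg_linear lT h; apply: rip_self_adjoint => // x y.
apply/eqP; rewrite -subr_eq0 -normr_le0; apply/ler_addgt0Pl => e e0; rewrite addr0.
set c := nrm x + nrm y + 1.
have c0 : 0 < c by rewrite ltr_wpDl // addr_ge0 ?nrm_ge0.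
have ec := divr_gt0 e0 c0.
have [N hN] := h x _ ec; have [N' hN'] := h y _ ec.
have {hN} h1 := hN _ (leq_maxl N N'); have {hN'} h2 := hN' _ (leq_maxr N N').
set n := maxn N N' in h1 h2; have st := self_adjoint_rip (sT n) x y.
have -> : rip (U x) y - rip x (U y) = rip x (T n y - U y) - rip (T n x - U x) y.
  by rewrite ripBl ripBr st; ring.
apply: le_trans (ler_normB _ _) _.
have := Cauchy_Schwarz x (T n y - U y); have := Cauchy_Schwarz (T n x - U x) y.
rewrite ltr_pdivlMr // in h1; rewrite ltr_pdivlMr // in h2.
rewrite /c in h1 h2; have := nrm_ge0 x; have := nrm_ge0 y.
have := nrm_ge0 (T n y - U y); have := nrm_ge0 (T n x - U x).
set a := nrm (T n x - _); set b := nrm (_ - U y).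
move: h1 h2; rewrite -/a -/b; set p := nrm x; set q := nrm y => h1 h2 a0 b0 q0 p0 h3 h4.
have h5 : q * e <= e * q by lra.
have : (a * q + b * p) * c <= e * c.
  have : a * c * q <= e * q by rewrite ler_wpM2r // ltW.
  have : b * c * p <= e * p by rewrite ler_wpM2r // ltW.
  by rewrite /c; lra.
by rewrite ler_pM2r // => h6; lra.
Qed.

Variable B : set (H -> H).
Hypotheses (Bcomm : commutative_ops B) (Bid : B idfun)
  (BD : forall T U, B T -> B U -> B (T + U))
  (BZ : forall (k : R[i]) T, B T -> B (k *: T))
  (BM : forall T U, B T -> B U -> B (T \o U))
  (Badj : forall T, B T -> exists2 U, B U & is_adjoint T U).

Lemma wo_closure_sub T : B T -> wo_closure B T.
Proof. by move=> BT s e e0; exists T => // p _; rewrite subrr normr0. Qed.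

Lemma wo_closureD T U : wo_closure B T -> wo_closure B U ->
  wo_closure B (fun x => T x + U x).
Proof.
move=> hT hU s e e0; have e2 : 0 < e / 2 by rewrite divr_gt0.
have [T' BT' hT'] := hT s _ e2; have [U' BU' hU'] := hU s _ e2.
exists (T' + U'); first exact: BD.
move=> p ps; rewrite /= !linearDl opprD addrACA [e]splitr.
by apply: le_lt_trans (ler_normD _ _) _; rewrite ltrD ?hT' ?hU'.
Qed.

Lemma wo_closureZ k T : wo_closure B T -> wo_closure B (fun x => k *: T x).
Proof.
move=> hT s e e0; have k1 : 0 < `|k| + 1 by rewrite ltr_wpDl.
have [T' BT' hT'] := hT s (e / (`|k| + 1)) (divr_gt0 e0 k1).
exists (k *: T'); first exact: BZ.
move=> p /hT'; rewrite /= !linearZl_LR -mulrBr normrM ltr_pdivlMr //.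
by apply: le_lt_trans; rewrite mulrC ler_wpM2l // lerDl.
Qed.

(** Multiplication is only separately weakly continuous. So [T] is approximated first, on the pairs
    (U x, y); the approximant [T'] is then fixed and moved to the right as its adjoint [V], which
    tells on which pairs (x, V y) to approximate [U]. *)
Lemma wo_closureM T U : wo_closure B T -> wo_closure B U ->
  wo_closure B (fun x => T (U x)).
Proof.
move=> hT hU s e e0; have e2 : 0 < e / 2 by rewrite divr_gt0.
have [T' BT' hT'] := hT [seq (U p.1, p.2) | p <- s] _ e2.
have [V BV aV] := Badj BT'.
have [U' BU' hU'] := hU [seq (p.1, V p.2) | p <- s] _ e2.
exists (T' \o U'); first exact: BM.
move=> p ps; rewrite [e]splitr.
have h1 := hT' _ (map_f _ ps); have h2 := hU' _ (map_f _ ps); rewrite /= in h1 h2.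
rewrite -!aV in h2; apply: le_lt_trans (ltrD h1 h2).
by apply: le_trans _ (ler_normD _ _); rewrite addrA subrK.
Qed.

(** The identity tested against y involves two matrix coefficients of [T], namely <T (U x), y> and
    <T x, V y>; both are weakly continuous in [T]. *)
Lemma wo_closure_comm U V : is_adjoint U V -> (forall T x, B T -> T (U x) = U (T x)) ->
  forall T x, wo_closure B T -> T (U x) = U (T x).
Proof.
move=> aU cU T x hT; apply: inner_sep => y; apply: inner_approx => e e0.
have e2 : 0 < e / 2 by rewrite divr_gt0.
have [T' BT' hT'] := hT [:: (U x, y); (x, V y)] _ e2.
have h1 := hT' (U x, y) (mem_head _ _).
have h2 : `|inner (T x) (V y) - inner (T' x) (V y)| < e / 2.
  by apply: (hT' (x, V y)); rewrite !inE eqxx orbT.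
rewrite /= in h1; rewrite -!aU -(cU T' x BT') distrC in h2; rewrite [e]splitr.
apply: le_lt_trans (ltrD h1 h2); apply: le_trans _ (ler_normD _ _).
by rewrite addrA subrK.
Qed.

Definition von_neumann_sa : set (H -> H) :=
  [set T | [/\ bounded_op T, self_adjoint T & wo_closure B T]].

Lemma von_neumann_sa_algebra : real_algebra von_neumann_sa.
Proof.
have comm T U x : von_neumann_sa T -> von_neumann_sa U -> T (U x) = U (T x).
  (* One variable at a time: [T] is first reduced to an element of [B], then [U] with that element
     fixed. *)
  move=> [_ _ wT] [_ sU wU]; apply: (wo_closure_comm sU) => // {wT}{}T {}x BT.
  have [V BV aV] := Badj BT; symmetry; apply: (wo_closure_comm aV) => //.
  by move=> T' z BT'; rewrite -[LHS]/((T' \o T) z) (Bcomm BT' BT).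
split.
- by move=> T [[]].
- by move=> T [].
- by split; [exact: bounded_op_id|move=> x y|exact: wo_closure_sub].
- move=> T U [bT sT wT] [bU sU wU].
  split; [exact: bounded_opD| |exact: wo_closureD].
  by move=> x y; rewrite /= linearDl linearDr /= sT sU.
- move=> r T [bT sT wT]; split; [exact: bounded_opZ| |exact: wo_closureZ].
  by move=> x y; rewrite linearZl_LR linearZr_LR /= conjR sT.
- move=> T U MT MU; have [[bT sT wT] [bU sU wU]] := (MT, MU).
  split; [exact: bounded_opM| |exact: wo_closureM].
  by move=> x y; rewrite sT sU (comm _ _ _ MT MU).
- exact: comm.
- move=> T U MT T1 h.
  have lT n : linear (T n) by have [[]] := MT n.
  have sT n : self_adjoint (T n) by have [] := MT n.
  split; [|exact: scvg_self_adjoint h|].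
    apply: (@bounded_op_real _ _ _ 1); first exact: scvg_linear h.
    by move=> x; rewrite mul1r; exact: scvg_nrm_le (h x) (fun n => T1 n x).
  move=> s e e0.
  have e0' : 0 < complex.Re e by move: e0; rewrite ltcE => /andP[].
  have eE : (complex.Re e)%:C = e.
    by move: e0; rewrite ltcE => /andP[/eqP /=]; case: (e) => p q /= ->.
  have [n hn] : exists N, forall n, (N <= n)%N -> forall p, p \in s ->
      `|inner (U p.1) p.2 - inner (T n p.1) p.2| < e / 2.
    elim: s => [|[x y] s [N hN]]; first by exists 0%N.
    have c0 : 0 < 4 * nrm y + 1 by have := nrm_ge0 y; lra.
    have [N' hN'] := h x _ (divr_gt0 e0' c0).
    exists (maxn N N') => n; rewrite geq_max => /andP[/hN Nn /hN' N'n] p.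
    rewrite inE => /predU1P[->|/Nn//] /=.
    rewrite -linearBl; apply: le_lt_trans (inner_le _ _) _.
    have -> : e / 2 = (complex.Re e / 2)%:C by rewrite rmorphM fmorphV rmorph_nat /= eE.
    rewrite ltcR.
    move: N'n; rewrite ltr_pdivlMr // nrmBC; have := nrm_ge0 (U x - T n x); lra.
  have e2 : 0 < e / 2 by rewrite divr_gt0.
  have [_ _ wT] := MT n; have [T' BT' hT'] := wT s _ e2.
  exists T' => // p ps; rewrite [e]splitr.
  apply: le_lt_trans (ltrD (hn n (leqnn n) p ps) (hT' p ps)).
  by apply: le_trans _ (ler_normD _ _); rewrite addrA subrK.
Qed.

End WeakClosure.

(** * C*-algebras and the range of a representation *)

(** [N] is kept abstract because the lemma serves both the norm of the C*-algebra and that of the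
    Hilbert space. *)
Lemma geometric_limit (R : realType) (V : zmodType) (N : V -> R) (u : nat -> V) (C r : R) :
  N 0 = 0 -> (forall x, N (- x) = N x) -> (forall x y, N (x + y) <= N x + N y) ->
  ((forall e, 0 < e -> exists k, forall m n, (k <= m)%N -> (k <= n)%N ->
      N (u m - u n) < e) ->
    exists l, forall e, 0 < e -> exists k, forall n, (k <= n)%N -> N (u n - l) < e) ->
  0 <= C -> 0 <= r -> r < 1 -> (forall n, N (u n.+1 - u n) <= C * r ^+ n) ->
  exists l, forall n, N (u n - l) <= C / (1 - r) * r ^+ n.
Proof.
move=> N0 NN ND compl C0 r0 r1 hu; have r1' : 0 < 1 - r by rewrite subr_gt0.
have rn n : 0 <= r ^+ n by rewrite exprn_ge0.
pose c := C / (1 - r); have c0 : 0 <= c by rewrite divr_ge0 // ltW.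
have cE : C = c * (1 - r) by rewrite divfK // gt_eqF.
(* The telescoped form of the geometric sum: C = c (1 - r) makes the induction close exactly. *)
have tail k n : N (u (n + k)%N - u n) <= c * (r ^+ n - r ^+ (n + k)).
  elim: k => [|k IH]; first by rewrite addn0 !subrr mulr0 N0.
  have -> : u (n + k.+1)%N - u n = (u (n + k).+1 - u (n + k)%N) + (u (n + k)%N - u n).
    by rewrite addnS addrA subrK.
  apply: le_trans (ND _ _) _; rewrite addnS exprS.
  have := hu (n + k)%N; rewrite {1}cE; lra.
have tail_le m n : (n <= m)%N -> N (u m - u n) <= c * r ^+ n.
  move=> /subnKC <-; apply: le_trans (tail _ _) _.
  by rewrite ler_wpM2l // gerBl.
have [l hl] : exists l, forall e, 0 < e -> exists k, forall n, (k <= n)%N -> N (u n - l) < e.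
  apply: compl => e e0; have [k hk] := exp_small c r0 r1 e0; exists k => m n km kn.
  case/orP: (leq_total m n) => mn.
    by rewrite -NN opprB; apply: le_lt_trans (tail_le _ _ mn) (hk _ km).
  exact: le_lt_trans (tail_le _ _ mn) (hk _ kn).
exists l => n; apply/ler_addgt0Pl => e e0; have [k hk] := hl _ e0.
have -> : u n - l = (u (maxn k n) - l) - (u (maxn k n) - u n).
  by rewrite opprB [RHS]addrC subrKA.
apply: le_trans (ND _ _) _; rewrite NN lerD ?tail_le ?leq_maxr //.
by apply/ltW/hk; rewrite leq_maxl.
Qed.

Lemma exp_zero (R : realType) (x C r : R) : 0 <= r -> r < 1 ->
  (forall n, x <= C * r ^+ n) -> x <= 0.
Proof.
move=> r0 r1 h; apply/ler_addgt0Pl => e e0; rewrite addr0.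
have [n hn] := exp_small C r0 r1 e0.
exact: le_trans (h n) (ltW (hn n (leqnn n))).
Qed.

(** * Square roots and resolvents in a C*-algebra *)

Section CStar.
Context {R : realType} {A : cstarAlgType R[i]}.
Implicit Types a b h x v : A.

Definition an a : R := complex.Re (cnorm a).

Lemma cnorm_ge0 a : 0 <= cnorm a.
Proof.
have := cnormD a (- a); rewrite subrr.
have -> : cnorm (0 : A) = 0 by rewrite -(scale0r (0 : A)) cnormZ normr0 mul0r.
by rewrite -scaleN1r cnormZ normrN1 mul1r -mulr2n pmulrn_lge0.
Qed.

Lemma cnormE a : cnorm a = (an a)%:C.
Proof.
rewrite /an; have := cnorm_ge0 a; rewrite lecE => /andP[/eqP /= h _].
by case: (cnorm a) h => p q /= ->.
Qed.

Lemma an_ge0 a : 0 <= an a. Proof. by rewrite -ler0c -cnormE cnorm_ge0. Qed.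

Lemma anD a b : an (a + b) <= an a + an b.
Proof. by rewrite -lecR rmorphD /= -!cnormE cnormD. Qed.

Lemma anZ (k : R[i]) a : an (k *: a) = complex.Re `|k| * an a.
Proof.
rewrite {1}/an cnormZ cnormE; have : 0 <= `|k| by [].
by rewrite lecE => /andP[/eqP /= k0 _]; case: `|k| k0 => p q /= ->; rewrite mul0r subr0.
Qed.

Lemma anZr (r : R) a : an (r%:C *: a) = `|r| * an a.
Proof. by rewrite anZ normc_real. Qed.

Lemma anN a : an (- a) = an a.
Proof. by rewrite -scaleN1r anZ normrN1 mul1r. Qed.

Lemma an0 : an 0 = 0.
Proof. by rewrite -(scale0r (0 : A)) anZ normr0 mul0r. Qed.

Lemma an0_eq0 a : an a = 0 -> a = 0.
Proof. by move=> h; apply: cnorm0_eq0; rewrite cnormE h. Qed.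

Lemma an_eq a b (C r : R) : 0 <= r -> r < 1 -> (forall n, an (a - b) <= C * r ^+ n) -> a = b.
Proof.
move=> r0 r1 /(exp_zero r0 r1) h; apply/eqP; rewrite -subr_eq0; apply/eqP/an0_eq0.
by apply/eqP; rewrite eq_le h an_ge0.
Qed.

Lemma anM a b : an (a * b) <= an a * an b.
Proof. by rewrite -lecR rmorphM /= -!cnormE cnormM. Qed.

Lemma an_sqr a : an (star a * a) = an a ^+ 2.
Proof. by apply: complexI; rewrite -cnormE cstar_identity cnormE -rmorphXn. Qed.

Lemma star0 : star 0 = 0 :> A.
Proof. by apply: (addIr (star 0)); rewrite -starD !add0r. Qed.

Lemma starN a : star (- a) = - star a.
Proof. by apply/eqP; rewrite -addr_eq0 -starD addNr star0. Qed.

Lemma star1 : star 1 = 1 :> A.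
Proof. by have := starM (star 1 : A) 1; rewrite mulr1 !starK mulr1 => <-. Qed.

Lemma an_star a : an (star a) = an a.
Proof.
have key b : an b <= an (star b).
  have [->|b0] := eqVneq b 0; first by rewrite star0.
  have p : 0 < an b by rewrite lt_def an_ge0 andbT; apply/eqP => /an0_eq0/eqP; apply/negP.
  by rewrite -(ler_pM2r p) -expr2 -an_sqr anM.
by apply/eqP; rewrite eq_le key -{2}(starK a) key.
Qed.

Lemma an1 : an (1 : A) = 1.
Proof.
have := an_sqr (1 : A); rewrite star1 mulr1 expr2 => h.
have n0 : an (1 : A) != 0 by apply/eqP => /an0_eq0/eqP; rewrite oner_eq0.
by apply: (mulfI n0); rewrite -h mulr1.
Qed.

Lemma an_geometric_limit (u : nat -> A) (C r : R) : 0 <= C -> 0 <= r -> r < 1 ->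
  (forall n, an (u n.+1 - u n) <= C * r ^+ n) ->
  exists l, forall n, an (u n - l) <= C / (1 - r) * r ^+ n.
Proof.
apply: geometric_limit; [exact: an0|exact: anN|exact: anD|].
move=> hu; have [|l hl] := @cnorm_complete _ _ u.
  move=> e; rewrite ltcE => /andP[/eqP e1 e2].
  have [k hk] := hu _ e2; exists k => m n km kn.
  by rewrite cnormE ltcE /= e1 eqxx hk.
exists l => e e0; have [|k hk] := hl e%:C; first by rewrite ltcR.
by exists k => n /hk; rewrite cnormE ltcR.
Qed.

Lemma starZr (r : R) a : star (r%:C *: a) = r%:C *: star a.
Proof. by rewrite starZ conjR. Qed.

(* c = 1 - l, where l is the fixed point of y |-> (h + y^2) / 2. *)
Lemma cstar_sqrt h : star h = h -> an h < 1 -> exists c, star c = c /\ c * c = 1 - h.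
Proof.
move=> sh; set r := an h => r1; have r0 : 0 <= r := an_ge0 h.
pose u := fix u n : A := if n is n.+1 then (2^-1)%:C *: (h + u n * u n) else 0.
have us n : star (u n) = u n.
  by elim: n => [|n IH]; rewrite /= ?star0 // starZr starD starM sh IH.
have ur n : an (u n) <= r.
  elim: n => [|n IH] /=; first by rewrite an0.
  rewrite anZr norm_half; have := anD h (u n * u n); have := anM (u n) (u n).
  have := an_ge0 (u n); rewrite -/r; nra.
(* This splitting is valid in a noncommutative ring. On the ball of radius [r], which contains all
   iterates, it makes the iteration contract by the factor [r]. *)
have sq a b : an (a * a - b * b) <= (an a + an b) * an (a - b).
  have -> : a * a - b * b = a * (a - b) + (a - b) * b.
    by rewrite mulrBr mulrBl addrA subrK.
  apply: le_trans (anD _ _) _; have := anM a (a - b); have := anM (a - b) b; lra.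
have ud n : an (u n.+1 - u n) <= 1 * r ^+ n.
  elim: n => [|n IH].
    by rewrite expr0 mulr1; apply: le_trans (ltW r1); rewrite subr0; exact: ur 1%N.
  have -> : u n.+2 - u n.+1 = (2^-1)%:C *: (u n.+1 * u n.+1 - u n * u n).
    by rewrite /= -scalerBr opprD addrACA subrr add0r.
  rewrite anZr norm_half exprS; have := sq (u n.+1) (u n); have := ur n; have := ur n.+1.
  have := an_ge0 (u n.+1 - u n); move: IH; set d := an (u n.+1 - u n).
  set s := an (_ - _); move=> h1 h2 h3 h4 h5.
  have : s <= 2 * r * d by apply: le_trans h5 _; rewrite ler_wpM2r //; lra.
  by have : r * d <= r * (1 * r ^+ n) by [rewrite ler_wpM2l]; lra.
have [l hl] := an_geometric_limit ler01 r0 r1 ud.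
set C := 1 / (1 - r) in hl.
have lE : l = (2^-1)%:C *: (h + l * l).
  apply: (@an_eq _ _ (C + (r + an l) * C) r) => // n.
  have -> : l - (2^-1)%:C *: (h + l * l) =
     (2^-1)%:C *: (u n * u n - l * l) - (u n.+1 - l).
    rewrite /= scalerBr !scalerDr; move: ((2^-1)%:C *: h) (_ *: (u n * u n)) => p s.
    by rewrite opprB [RHS]addrC [in RHS](opprD p s) (addrA l) subrKA opprD addrA.
  apply: le_trans (anD _ _) _; rewrite anN anZr norm_half.
  have := hl n; have := hl n.+1; have := sq (u n) l; have := ur n.
  have := an_ge0 (u n - l); have := an_ge0 l; rewrite exprS.
  set d := an (u n - l); set d' := an (u n.+1 - l); set s := an (_ - l * l).
  move=> l0 d0 h1 h2 h3 h4.
  have : 0 <= C * r ^+ n by apply: le_trans d0 h4.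
  set e := C * r ^+ n => e0.
  have h5 : s <= (r + an l) * e.
    by apply: le_trans h2 _; apply: ler_pM => //; [rewrite addr_ge0 ?an_ge0|lra].
  have h6 : C * (r * r ^+ n) <= e by rewrite mulrCA -/e ler_piMl // ltW.
  have h7 : 0 <= (r + an l) * e by rewrite mulr_ge0 ?addr_ge0.
  by rewrite mulrDl -mulrA -/e; lra.
have ls : star l = l.
  apply: (@an_eq _ _ (C + C) r) => // n.
  have -> : star l - l = (u n - l) - star (u n - l).
    by rewrite starD starN us opprB [RHS]addrC subrKA.
  apply: le_trans (anD _ _) _; rewrite anN an_star; have := hl n; lra.
exists (1 - l); split; first by rewrite starD starN star1 ls.
have e2 : l + l = h + l * l by rewrite {1 2}lE -scalerDl half_half scale1r.
rewrite mulrBr !mulrBl !mulr1 mul1r.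
have -> : l - l * l = h - l.
  by apply/eqP; rewrite subr_eq addrAC eq_sym subr_eq e2.
by rewrite opprB addrA subrK.
Qed.

Section Cayley.
Variable x : A.
Hypothesis sx : star x = x.

Local Notation I := ('i *: (1 : A)).

Let star_i : star I = - I.
Proof.
by rewrite starZ star1 -scaleNr; congr (_ *: _); apply/eqP; rewrite eq_complex /= oppr0 !eqxx.
Qed.

Let xi (t : R[i]) : (x + t *: 1) * (x - t *: 1) = x * x - (t * t) *: 1.
Proof.
rewrite mulrDl !mulrBr -!scalerAl -!scalerAr !mul1r !mulr1 scalerA.
by rewrite addrA subrK.
Qed.

Let xcomm : (x + I) * (x - I) = (x - I) * (x + I).
Proof. by rewrite xi; have := xi (- 'i); rewrite scaleNr opprK mulrNN. Qed.

(** For x of any norm, x + i = (x - i s) + i (1 + s), and a large enough [s] makes the second term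
    dominate: the C*-identity gives |x - i s|^2 <= |x|^2 + s^2, which for s = |x|^2 is below (1 +
    s)^2. A Neumann series then inverts x + i. *)
Lemma resolvent : exists v, [/\ v * (x + I) = 1, (x + I) * v = 1 & an v <= 1].
Proof.
pose s := an x ^+ 2; have s0 : 0 <= s by rewrite sqr_ge0.
pose t := 1 + s; have t0 : 0 < t by rewrite ltr_wpDr.
pose p : R[i] := 'i * t%:C.
have pn0 : p != 0.
  by rewrite mulf_eq0 negb_or; apply/andP; split; rewrite eq_complex /= ?oner_eq0 ?andbF // gt_eqF.
pose z := x - ('i * s%:C) *: 1.
pose k := - p^-1 *: z.
have xE : x + I = p *: (1 - k).
  have pE : p *: (1 : A) = ('i * s%:C) *: 1 + I.
    by rewrite /p /t rmorphD rmorph1 mulrDr mulr1 scalerDl addrC.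
  by rewrite scalerBr /k scalerA mulrN mulfV // scaleN1r opprK pE [RHS]addrC subrKA.
have star_z : star z = x + ('i * s%:C) *: 1.
  by rewrite /z (mulrC 'i) -!scalerA starD starN sx starZr star_i scalerN opprK.
have r1 : an k < 1.
  have h : an z ^+ 2 <= s + s ^+ 2.
    rewrite -an_sqr star_z xi; apply: le_trans (anD _ _) _; rewrite anN anZ an1.
    have -> : 'i * s%:C * ('i * s%:C) = - (s ^+ 2)%:C.
      by rewrite mulrACA -expr2 sqr_i mulN1r -rmorphM expr2.
    rewrite normrN normc_real mulr1 lerD // ?anM //.
    by rewrite ger0_norm // sqr_ge0.
  have -> : an k = an z / t.
    rewrite /k scaleNr anN anZ normfV normrM normc_i normc_real ger0_norm ?(ltW t0) //.
    by rewrite mul1r -fmorphV mulrC.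
  rewrite ltr_pdivrMr // mul1r -(@ltr_pXn2r _ 2) ?nnegrE ?an_ge0 ?(ltW t0) //.
  by apply: le_lt_trans h _; rewrite /t; nra.
have r0 := an_ge0 k; set r := an k in r1 r0.
have kn n : an (k ^+ n) <= r ^+ n.
  elim: n => [|n IH]; first by rewrite !expr0 an1.
  by rewrite !exprS; apply: le_trans (anM _ _) _; rewrite ler_wpM2l.
pose u n : A := \sum_(j < n) k ^+ j.
have ud n : an (u n.+1 - u n) <= 1 * r ^+ n by rewrite /u big_ord_recr /= addrAC subrr add0r mul1r.
have [l hl] := an_geometric_limit ler01 r0 r1 ud; set C := 1 / (1 - r) in hl.
have ul n : u n * (1 - k) = 1 - k ^+ n.
  elim: n => [|n IH]; first by rewrite /u big_ord0 mul0r subrr.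
  by rewrite /u big_ord_recr /= mulrDl IH mulrBr mulr1 -exprSr addrA subrK.
have ur n : (1 - k) * u n = 1 - k ^+ n.
  elim: n => [|n IH]; first by rewrite /u big_ord0 mulr0 subrr.
  by rewrite /u big_ord_recr /= mulrDr IH mulrBl mul1r -exprS addrA subrK.
have bound n a : an a <= an (1 - k) * (C * r ^+ n) ->
    an (a + k ^+ n) <= (an (1 - k) * C + 1) * r ^+ n.
  by move=> h; apply: le_trans (anD _ _) _; have := kn n; rewrite mulrDl mul1r -mulrA; lra.
have lk : l * (1 - k) = 1.
  apply: (@an_eq _ _ (an (1 - k) * C + 1) r) => // n.
  have -> : l * (1 - k) - 1 = - ((u n - l) * (1 - k) + k ^+ n).
    by rewrite mulrBl ul addrAC subrK opprB.
  rewrite anN; apply: bound; apply: le_trans (anM _ _) _.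
  by rewrite mulrC ler_wpM2l ?an_ge0.
have kl : (1 - k) * l = 1.
  apply: (@an_eq _ _ (an (1 - k) * C + 1) r) => // n.
  have -> : (1 - k) * l - 1 = - ((1 - k) * (u n - l) + k ^+ n).
    by rewrite mulrBr ur addrAC subrK opprB.
  rewrite anN; apply: bound; apply: le_trans (anM _ _) _.
  by rewrite ler_wpM2l ?an_ge0.
pose v := p^-1 *: l.
have vx : v * (x + I) = 1 by rewrite xE -scalerAl -scalerAr lk scalerA mulVf ?scale1r.
have xv : (x + I) * v = 1 by rewrite xE -scalerAl -scalerAr kl scalerA mulfV ?scale1r.
exists v; split=> //.
have sxi : star (x + I) = x - I by rewrite starD sx star_i.
(* [w] is the Cayley transform (x - i) (x + i)^-1, hence unitary of norm 1; so 2 i v = 1 - w has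
   norm at most 2. *)
pose w := 1 - ('i + 'i) *: v.
have wE : w = (x - I) * v.
  have -> : (x - I) * v = (x + I) * v - (I * v + I * v).
    by rewrite mulrBl mulrDl opprD addrA addrK.
  by rewrite xv -scalerAl mul1r /w scalerDl.
have an_w : an w = 1.
  apply/eqP; rewrite -(@eqrXn2 _ 2) ?an_ge0 // -an_sqr wE starM.
  have -> : star (x - I) = x + I by rewrite -sxi starK.
  rewrite -mulrA (mulrA (x + I)) xcomm -(mulrA (x - I)) xv mulr1 -sxi -starM xv star1.
  by rewrite an1 expr1n.
have : an (('i + 'i) *: v) <= 2.
  have -> : ('i + 'i) *: v = 1 - w by rewrite subKr.
  by apply: le_trans (anD _ _) _; rewrite anN an_w an1.
have -> : 'i + 'i = (2 : R)%:C * 'i.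
  by apply/eqP; rewrite eq_complex /=; apply/andP; split; apply/eqP; ring.
rewrite -scalerA anZr anZ Re_norm_i mul1r ger0_norm //; lra.
Qed.

(* y = x / (1 + x^2). *)
Lemma half_cayley : exists y, an y <= 1 /\ x - y = x * x * y /\ star y = y.
Proof.
have [v [vx xv v1]] := resolvent.
have sxi : star (x + I) = x - I by rewrite starD sx star_i.
have xsv : (x - I) * star v = 1 by rewrite -sxi -starM vx star1.
have x2' : x * x = (x + I) * (x - I) - 1.
  by rewrite xi -(expr2 'i) sqr_i scaleN1r opprK addrK.
have x2 : x * x = (x - I) * (x + I) - 1 by rewrite -xcomm.
(* As v = (x + i)^-1 and its star is (x - i)^-1, the real part of [v] is x / (1 + x^2), and it
   inherits the bound 1. *)
exists ((2^-1)%:C *: (v + star v)); split; last split.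
- rewrite anZr ger0_norm ?invr_ge0 //; have := anD v (star v); rewrite an_star; lra.
- rewrite -scalerAr mulrDr {1}x2 x2' [(_ - 1) * v]mulrBl [(_ - 1) * star v]mulrBl.
  rewrite -!mulrA xv xsv !mulr1 !mul1r.
  have -> : x - I - v + (x + I - star v) = (x + x) - (v + star v).
    by rewrite addrACA -opprD addrACA addNr addr0.
  by rewrite scalerBr [_ *: (x + x)]scalerDr -scalerDl half_half scale1r.
- by rewrite starZr starD starK addrC.
Qed.

End Cayley.
End CStar.

(** * Norm closedness of the range of a representation *)

Section Range.
Context {R : realType} {A : cstarAlgType R[i]} {H : hilbertType R[i]}.
Variables (pi : A -> H -> H) (hpi : representation pi).
Implicit Types (a b h x : A) (z : H).

Let pD a b z : pi (a + b) z = pi a z + pi b z.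
Proof. by rewrite (representationD hpi). Qed.
Let pZ k a z : pi (k *: a) z = k *: pi a z.
Proof. by rewrite (representationZ hpi). Qed.
Let pN a z : pi (- a) z = - pi a z.
Proof. by rewrite -scaleN1r pZ scaleN1r. Qed.
Let pM a b z : pi (a * b) z = pi a (pi b z).
Proof. by rewrite (representationM hpi). Qed.
Let p1 z : pi 1 z = z.
Proof. by rewrite (representation1 hpi). Qed.
Let pS a y z : rip (pi a y) z = rip y (pi (star a) z).
Proof. by rewrite /rip (representation_star hpi). Qed.

(* For an b < 1, the element 1 - b^* b is a square, so its image is positive. *)
Lemma representation_nonexpansive a z : nrm (pi a z) <= an a * nrm z.
Proof.
have key b : an b < 1 -> nrm (pi b z) <= nrm z.
  move=> b1; have b0 := an_ge0 b; have [||c [sc cc]] := @cstar_sqrt _ _ (star b * b) _ _.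
  - by rewrite starM starK.
  - by rewrite an_sqr; nra.
  have := rip_ge0 (pi c z); rewrite pS sc -pM cc pD pN p1 pM ripDr ripNr.
  have := pS b z (pi b z); rewrite !rip_nrm => <-.
  by rewrite subr_ge0 ler_pXn2r ?nnegrE ?nrm_ge0.
apply/ler_addgt0Pl => e e0.
have n1 : 0 < nrm z + 1 by rewrite ltr_wpDl ?nrm_ge0.
pose d := an a + e / (nrm z + 1).
have d0 : an a < d by rewrite ltrDl divr_gt0.
have dp : 0 < d by apply: le_lt_trans d0; exact: an_ge0.
have := key ((d^-1)%:C *: a); rewrite anZr ger0_norm ?invr_ge0 ?(ltW dp) //.
rewrite mulrC ltr_pdivrMr // mul1r => /(_ d0).
rewrite pZ nrmZ ger0_norm ?invr_ge0 ?(ltW dp) // ler_pdivrMl // => h.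
apply: le_trans h _; rewrite /d mulrDl addrC lerD2r.
rewrite mulrAC ler_pdivrMr // ler_wpM2l ?(ltW e0) //; lra.
Qed.

(** Since x - y = x^2 y, the error is quadratic in the norm of [pi x], while [y] has norm at most 1
    however large [x] is. *)
Lemma lift_self_adjoint x (t : R) : star x = x -> 0 <= t ->
  (forall z, nrm (pi x z) <= t * nrm z) ->
  exists2 y, an y <= 1 & forall z, nrm (pi (x - y) z) <= t ^+ 2 * nrm z.
Proof.
move=> sx t0 xt; have [y [y1 [xy sy]]] := half_cayley sx; exists y => // z.
rewrite xy !pM; apply: le_trans (xt _) _; rewrite expr2 -mulrA ler_wpM2l //.
apply: le_trans (xt _) _; rewrite ler_wpM2l //.
by apply: le_trans (representation_nonexpansive _ _) _; rewrite ler_piMl ?nrm_ge0.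
Qed.

Lemma star_bound a (d : R) : 0 <= d -> (forall z, nrm (pi a z) <= d * nrm z) ->
  forall z, nrm (pi (star a) z) <= d * nrm z.
Proof.
move=> d0 h z; have := Cauchy_Schwarz (pi a (pi (star a) z)) z.
rewrite pS rip_nrm ger0_norm ?sqr_ge0 // expr2 => h2.
have [->|n0] := eqVneq (nrm (pi (star a) z)) 0; first by rewrite mulr_ge0 ?nrm_ge0.
have np : 0 < nrm (pi (star a) z) by rewrite lt_def n0 nrm_ge0.
rewrite -(ler_pM2l np); apply: le_trans h2 _.
by have := h (pi (star a) z); have := nrm_ge0 z; nra.
Qed.

Lemma lift_self_adjoint_scaled x (d : R) : star x = x -> 0 < d ->
  (forall z, nrm (pi x z) <= d * nrm z) ->
  exists2 y, an y <= 16 * d & forall z, nrm (pi (x - y) z) <= d / 16 * nrm z.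
Proof.
(* Dividing by 16 d brings the norm of the image to 1/16; scaling back, the quadratic error is 16 d
   / 16^2 = d / 16. *)
move=> sx d0 xd; pose c : R := 16 * d; have c0 : 0 < c by rewrite /c; lra.
have [||z|y y1 hy] := @lift_self_adjoint ((c^-1)%:C *: x) (1 / 16).
- by rewrite starZr sx.
- by lra.
- rewrite pZ nrmZ ger0_norm ?invr_ge0 ?(ltW c0) // ler_pdivrMl //.
  by apply: le_trans (xd z) _; rewrite /c; lra.
exists (c%:C *: y); first by rewrite anZr ger0_norm ?(ltW c0) // ler_piMr // ltW.
move=> z; have -> : x - c%:C *: y = c%:C *: ((c^-1)%:C *: x - y).
  by rewrite scalerBr scalerA -rmorphM mulfV ?gt_eqF // rmorph1 scale1r.
rewrite pZ nrmZ ger0_norm ?(ltW c0) //.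
apply: le_trans (ler_wpM2l (ltW c0) (hy z)) _; rewrite /c expr2; lra.
Qed.

Lemma lift a (d : R) : 0 < d -> (forall z, nrm (pi a z) <= d * nrm z) ->
  exists2 y, an y <= 32 * d & forall z, nrm (pi (a - y) z) <= d / 8 * nrm z.
Proof.
move=> d0 ad; have sd := star_bound (ltW d0) ad.
pose x1 := (2^-1)%:C *: (a + star a).
pose x2 := (2^-1)%:C *: (- 'i *: (a - star a)).
have s1 : star x1 = x1 by rewrite starZr starD starK addrC.
have s2 : star x2 = x2.
  rewrite starZr starZ starD starN starK -[star a - a]opprB scalerN -scaleNr.
  by congr (_ *: (_ *: _)); apply/eqP; rewrite eq_complex /= !oppr0 opprK !eqxx.
have aE : a = x1 + 'i *: x2.
  have iw : 'i * (2^-1)%:C * - 'i = (2^-1)%:C :> R[i].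
    by apply/eqP; rewrite eq_complex /=; apply/andP; split; apply/eqP; ring.
  rewrite /x1 /x2 !scalerA iw -scalerDr.
  by rewrite addrACA subrr addr0 scalerDr -scalerDl half_half scale1r.
have b1 z : nrm (pi x1 z) <= d * nrm z.
  rewrite pZ pD nrmZ norm_half; have := nrmD (pi a z) (pi (star a) z).
  have := ad z; have := sd z; lra.
have b2 z : nrm (pi x2 z) <= d * nrm z.
  rewrite !pZ nrmZ nrm_scale normrN Re_norm_i mul1r norm_half pD pN.
  have := nrmB (pi a z) (pi (star a) z); have := ad z; have := sd z; lra.
have [y1 h1 e1] := lift_self_adjoint_scaled s1 d0 b1.
have [y2 h2 e2] := lift_self_adjoint_scaled s2 d0 b2.
exists (y1 + 'i *: y2).
  by apply: le_trans (anD _ _) _; rewrite anZ Re_norm_i mul1r; lra.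
move=> z; have -> : a - (y1 + 'i *: y2) = (x1 - y1) + 'i *: (x2 - y2).
  by rewrite {1}aE opprD addrACA scalerBr.
rewrite pD pZ; apply: le_trans (nrmD _ _) _; rewrite nrm_scale Re_norm_i mul1r.
by have := e1 z; have := e2 z; lra.
Qed.

Lemma opnorm_leR (T : H -> H) (r : R) :
  opnorm_le T r%:C <-> forall z, nrm (T z) <= r * nrm z.
Proof. by split=> h z; have := h z; rewrite !nrmE -rmorphM lecR. Qed.

(** Approximants of [T] in the range may have preimages that do not converge. Each correction is
    therefore replaced by a lift of comparable norm, and the corrected preimages form a Cauchy
    sequence in [A]. This takes the place of passing to the quotient by the kernel. *)
Lemma range_norm_closed : norm_closed (range pi).
Proof.
move=> T bT hT.
have app (e : R) : 0 < e -> exists a, forall z, nrm (T z - pi a z) <= e * nrm z.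
  move=> e0; have [|_ [a _ <-] h] := hT e%:C; first by rewrite ltcR.
  by exists a; exact/opnorm_leR.
pose ok n a := forall z, nrm (T z - pi a z) <= 2^-1 ^+ n * nrm z.
have pn n : 0 < 2^-1 ^+ n :> R by rewrite exprn_gt0 // invr_gt0.
(* The implication stands under the existential so that [choice] yields a total function, with value
   0 where [ok n a] fails. With e = 2^-n, the increment has an image of norm at most 5/4 e; [lift]
   gives it norm 32 * 5/4 e = 40 e and leaves the error 5/32 e, and 1/4 + 5/32 is below 1/2. *)
have step n a : exists b, ok n a -> ok n.+1 b /\ an (b - a) <= 40 * 2^-1 ^+ n.
  set e : R := 2^-1 ^+ n; have e0 : 0 < e := pn n.
  have [x hx] := app (e / 4) (ltac:(lra)).
  have [nok|ok_a] := pselect (~ ok n a); first by exists 0 => /nok.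
  have {}ok_a : ok n a by apply: contrapT.
  have w z : nrm (pi (x - a) z) <= 5 / 4 * e * nrm z.
    have -> : pi (x - a) z = (T z - pi a z) - (T z - pi x z).
      by rewrite pD pN opprB [RHS]addrC subrKA.
    have := nrmB (T z - pi a z) (T z - pi x z); have := hx z; have := ok_a z.
    by rewrite -/e; lra.
  have [y y1 hy] := lift (ltac:(lra) : 0 < 5 / 4 * e) w.
  exists (a + y) => _; split; last by rewrite addrC addKr; lra.
  move=> z; have -> : T z - pi (a + y) z = (T z - pi x z) + pi (x - a - y) z.
    by rewrite !pD !pN opprD !addrA subrK.
  apply: le_trans (nrmD _ _) _; rewrite exprS -/e.
  have := hy z; have := hx z; have := mulr_ge0 (ltW e0) (nrm_ge0 z); lra.
have [f hf] := choice (fun p : nat * A => step p.1 p.2).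
have [a0 ha0] := app 1 ltr01.
pose u := fix u n : A := if n is n.+1 then f (n, u n) else a0.
have uok n : ok n (u n).
  elim: n => [|n IH]; first by move=> z; rewrite expr0; exact: ha0.
  by have [] := hf (n, u n) IH.
have ud n : an (u n.+1 - u n) <= 40 * 2^-1 ^+ n.
  by have [] := hf (n, u n) (uok n).
have [l hl] := an_geometric_limit (ltac:(lra) : 0 <= 40 :> R)
  (ltac:(lra) : 0 <= 2^-1 :> R) (ltac:(lra) : 2^-1 < 1 :> R) ud.
exists l => //; apply/funext => z; apply/eqP; rewrite -subr_eq0; apply/eqP/nrm0_eq0/eqP.
rewrite eq_le nrm_ge0 andbT.
apply: (@exp_zero _ _ ((1 + 40 / (1 - 2^-1)) * nrm z) 2^-1); [lra|lra|move=> n].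
rewrite nrmBC; have -> : T z - pi l z = (T z - pi (u n) z) + pi (u n - l) z.
  by rewrite pD pN addrA subrK.
apply: le_trans (nrmD _ _) _; have := uok n z.
have := representation_nonexpansive (u n - l) z.
have := ler_wpM2r (nrm_ge0 z) (hl n); lra.
Qed.

Lemma range_cstar_subalgebra : cstar_subalgebra (range pi).
Proof.
split.
- by move=> _ [a _ <-]; exact: representation_bounded.
- by exists 1 => //; exact: representation1.
- by move=> _ _ [a _ <-] [b _ <-]; exists (a + b) => //; exact: representationD.
- by move=> k _ [a _ <-]; exists (k *: a) => //; exact: representationZ.
- by move=> _ _ [a _ <-] [b _ <-]; exists (a * b) => //; exact: representationM.
- move=> _ U [a _ <-] adj; exists (star a) => //; apply/funext => y.
  apply: inner_sep => x; rewrite innerC -(representation_star hpi) adj.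
  by rewrite -innerC.
- exact: range_norm_closed.
Qed.

End Range.

(** [P] also witnesses that the intersection runs over a nonempty family, whence its members are
    bounded operators. *)
Lemma cstar_generated_min (R : realType) (H : hilbertType R[i]) (G P : set (H -> H)) :
  cstar_subalgebra P -> G `<=` P ->
  [/\ cstar_subalgebra (cstar_generated G), G `<=` cstar_generated G &
      cstar_generated G `<=` P].
Proof.
move=> hP GP; have sub : cstar_generated G `<=` P by move=> T; apply; split.
split=> //; last by move=> T GT Q [_]; apply.
split.
- by move=> T /sub; exact: (cstar_subalgebra_bounded hP).
- by move=> Q [hQ _]; exact: (cstar_subalgebra_id hQ).
- by move=> T U hT hU Q hQ; apply: (cstar_subalgebraD hQ.1); [exact: hT|exact: hU].
- by move=> k T hT Q hQ; apply: (cstar_subalgebraZ hQ.1); exact: hT.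
- by move=> T U hT hU Q hQ; apply: (cstar_subalgebraM hQ.1); [exact: hT|exact: hU].
- by move=> T U hT adj Q hQ; apply: (cstar_subalgebra_adj hQ.1 _ adj); exact: hT.
- move=> T bT hT Q hQ; apply: (cstar_subalgebra_closed hQ.1) => // e e0.
  by have [U hU TU] := hT e e0; exists U => //; exact: hU.
Qed.

(** * Positivity of density states *)

Section OperatorSquareRoot.
Context {R : realType} {H : hilbertType R[i]}.
Implicit Types (x y z : H) (T U V Q : H -> H).

Variables (h : H -> H) (r : R).
Hypotheses (hlin : linear h) (hsym : forall x y, rip (h x) y = rip x (h y)).
Hypotheses (hr : forall x, nrm (h x) <= r * nrm x) (r0 : 0 <= r) (r1 : r < 1).

(** The iteration of [cstar_sqrt], kept as polynomials so that the iterates at [h] commute with each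
    other and with everything that commutes with [h]. *)
Fixpoint sqrt_poly n : {poly R} :=
  if n is n.+1 then (2^-1)%:P * ('X + sqrt_poly n ^+ 2) else 0.

Let u n x := ev h (sqrt_poly n) x.

Let uS n x : u n.+1 x = (2^-1)%:C *: (h x + u n (u n x)).
Proof. by rewrite /u /= evCM // evD evX expr2 evM. Qed.

Let ulin n : linear (u n). Proof. exact: ev_linear. Qed.

Let ur n x : nrm (u n x) <= r * nrm x.
Proof.
elim: n x => [|n IH] x; first by rewrite /u /= -polyC0 evC scale0r nrm0 mulr_ge0 ?nrm_ge0.
rewrite uS nrmZ norm_half; have := nrmD (h x) (u n (u n x)); have := hr x.
have := IH x; have := IH (u n x); have := mulr_ge0 r0 (nrm_ge0 x).
have : r * nrm (u n x) <= nrm (u n x) by rewrite ler_piMl ?nrm_ge0 // ltW.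
lra.
Qed.

Let ud n x : nrm (u n.+1 x - u n x) <= nrm x * r ^+ n.
Proof.
elim: n x => [|n IH] x.
  rewrite expr0 mulr1 {2}/u /= -polyC0 evC scale0r subr0.
  by apply: le_trans (ur _ _) _; rewrite ler_piMl ?nrm_ge0 // ltW.
have -> : u n.+2 x - u n.+1 x = (2^-1)%:C *: ((u n.+1 (u n.+1 x - u n x)) + u n (u n.+1 x - u n x)).
  rewrite (linear_B (ulin n.+1)) (linear_B (ulin n)).
  have -> : u n.+1 (u n x) = u n (u n.+1 x) by rewrite /u -!evM // mulrC.
  apply: rip_eq => z; have := congr1 (rip^~ z) (uS n.+1 x).
  have := congr1 (rip^~ z) (uS n x); rewrite /= !(ripDl, ripNl, ripZl); lra.
rewrite nrmZ norm_half exprS.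
have := nrmD (u n.+1 (u n.+1 x - u n x)) (u n (u n.+1 x - u n x)).
have := ur n.+1 (u n.+1 x - u n x); have := ur n (u n.+1 x - u n x).
have := ler_wpM2l r0 (IH x); lra.
Qed.

Lemma op_sqrt : exists c, [/\ linear c, self_adjoint c,
  (forall x, nrm (c x) <= 2 * nrm x), (forall x, c (c x) = x - h x) &
  forall T, bounded_op T -> (forall x, T (h x) = h (T x)) -> forall x, T (c x) = c (T x)].
Proof.
have cv x : exists l, scvg (u ^~ x) l.
  have [|l hl] := geometric_limit nrm0 nrmN (@nrmD _ _) _ (nrm_ge0 x) r0 r1 (ud ^~ x).
    exact: complete.
  exists l => e e0; have [N hN] := exp_small (nrm x / (1 - r)) r0 r1 e0.
  by exists N => n /hN; apply: le_lt_trans.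
have [l hl] := choice cv.
have usa n : self_adjoint (u n) by apply: rip_self_adjoint => // x y; exact: ev_sym.
have llin := scvg_linear ulin hl; have lsa := scvg_self_adjoint ulin usa hl.
have lr x : nrm (l x) <= r * nrm x by exact: scvg_nrm_le (hl x) (fun n => ur n x).
have lE x : l x = (2^-1)%:C *: (h x + l (l x)).
  apply: (@scvg_unique _ _ (fun n => u n.+1 x)) => e e0.
    by have [N hN] := hl x e e0; exists N => n Nn; apply: hN; exact: leqW.
  have [N hN] := hl x e e0; have [N' hN'] := hl (l x) e e0; exists (maxn N N') => n.
  rewrite geq_max => /andP[/hN h1 /hN' h2]; rewrite uS.
  have -> : (2^-1)%:C *: (h x + u n (u n x)) - (2^-1)%:C *: (h x + l (l x)) =
     (2^-1)%:C *: (u n (u n x - l x) + (u n (l x) - l (l x))).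
    by rewrite (linear_B (ulin n)); apply: rip_eq => z; rewrite !(ripDl, ripNl, ripZl); ring.
  rewrite nrmZ norm_half; have := nrmD (u n (u n x - l x)) (u n (l x) - l (l x)).
  have := ur n (u n x - l x); have := nrm_ge0 (u n x - l x); have := ltW r1.
  move=> r1' p q s; have : r * nrm (u n x - l x) <= nrm (u n x - l x) by rewrite ler_piMl.
  lra.
exists (fun x => x - l x); split.
- by move=> k x y; rewrite llin scalerBr opprD addrACA.
- by move=> x y; rewrite linearBl linearBr /= lsa.
- by move=> x; have := nrmB x (l x); have := lr x; have := ler_wpM2r (nrm_ge0 x) (ltW r1); lra.
- move=> x; rewrite (linear_B llin); apply: rip_eq => z.
  by have := congr1 (rip^~ z) (lE x); rewrite /= !(ripDl, ripNl, ripZl); lra.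
- move=> T /bounded_opE[Tlin [c c0 hc]] Th x; rewrite (linear_B Tlin); congr (_ - _).
  apply: (@scvg_unique _ _ (fun n => T (u n x))); first exact: scvg_bounded hc (hl x).
  move=> e e0; have [N hN] := hl (T x) e e0; exists N => n /hN.
  suff -> : T (u n x) = u n (T x) by [].
  rewrite /u; elim/poly_ind: (sqrt_poly n) {hN} x => [|p k IH] x.
    by rewrite -polyC0 !evC !scale0r linear_0.
  by rewrite !evD !evMX !evC (linear_D Tlin) (linear_Z Tlin) -Th IH.
Qed.

End OperatorSquareRoot.

(** [has_trace] quantifies over all bases, so it determines its value only once a basis is known to
    exist. *)
Lemma orthonormal_basis_exists (R : realType) (H : hilbertType R[i]) :
  exists E : set H, orthonormal_basis E.
Proof.
pose P (E : set H) := forall x y, E x -> E y -> inner x y = (x == y)%:R.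
have [F FP tot|E [PE maxE]] := @Zorn_bigcup H P.
  move=> x y [X FX Xx] [Y FY Yy]; case: (tot X Y FX FY) => s.
    by apply: (FP Y) => //; exact: s.
  by apply: (FP X) => //; exact: s.
exists E; split=> // x hx; apply: contrapT => x0.
have n0 : `|x| != 0 by rewrite normr_eq0; apply/eqP.
pose e := `|x|^-1 *: x.
have cn : Num.conj `|x|^-1 = `|x|^-1 by rewrite geC0_conj // invr_ge0.
have ee : inner e e = 1.
  by rewrite linearZl_LR linearZr_LR /= cn inner_norm expr2 mulKf // mulVf.
have ey y : E y -> inner e y = 0 by move=> Ey; rewrite linearZl_LR /= hx ?mulr0.
have Ee : ~ E e.
  by move=> /ey; rewrite ee => /eqP; rewrite oner_eq0.
apply: (maxE (E `|` [set e])); first by split; [move=> ? ?; left|move=> s; apply/Ee/s; right].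
have ney y : E y -> (e == y) = false.
  by move=> Ey; apply/eqP => ey'; apply: Ee; rewrite ey'.
move=> y z [Ey|->] [Ez|->].
- exact: PE.
- by rewrite innerC ey // conjc0 eq_sym ney.
- by rewrite ey // ney.
- by rewrite ee eqxx.
Qed.

(** * Unordered sums *)

Section UnorderedSums.
Context {R : realType} {I : choiceType}.
Implicit Types (E : set I) (f g : I -> R[i]) (s t : R[i]).

Lemma has_sum_unique E f s t : has_sum E f s -> has_sum E f t -> s = t.
Proof.
move=> hs ht; apply: inner_approx => e e0; have e2 : 0 < e / 2 by rewrite divr_gt0.
have [F FE hF] := hs _ e2; have [G GE hG] := ht _ e2.
have FGE : [set` (F `|` G)%fset] `<=` E.
  by move=> x /=; rewrite inE => /orP[/FE|/GE].
have h1 := hF (F `|` G)%fset (fsubsetUl _ _) FGE.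
have h2 := hG (F `|` G)%fset (fsubsetUr _ _) FGE.
rewrite distrC in h1; rewrite [e]splitr; apply: le_lt_trans (ltrD h1 h2).
by apply: le_trans _ (ler_normD _ _); rewrite addrA subrK.
Qed.

Lemma has_sumD E f g s t : has_sum E f s -> has_sum E g t ->
  has_sum E (fun x => f x + g x) (s + t).
Proof.
move=> hs ht e e0; have e2 : 0 < e / 2 by rewrite divr_gt0.
have [F FE hF] := hs _ e2; have [G GE hG] := ht _ e2.
exists (F `|` G)%fset; first by move=> x /=; rewrite inE => /orP[/FE|/GE].
move=> K; rewrite fsubUset => /andP[FK GK] KE.
rewrite big_split opprD addrACA [e]splitr.
exact: le_lt_trans (ler_normD _ _) (ltrD (hF _ FK KE) (hG _ GK KE)).
Qed.

Lemma has_sumZ E f s (k : R[i]) : has_sum E f s -> has_sum E (fun x => k * f x) (k * s).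
Proof.
move=> hs e e0; have k1 : 0 < `|k| + 1 by rewrite ltr_wpDl.
have [F FE hF] := hs (e / (`|k| + 1)) (divr_gt0 e0 k1); exists F => // G FG GE.
rewrite -mulr_sumr -mulrBr normrM; have := hF G FG GE; rewrite ltr_pdivlMr //.
by apply: le_lt_trans; rewrite mulrC ler_wpM2l // lerDl.
Qed.

Lemma has_sum_ge0 E f s : (forall x, E x -> 0 <= f x) -> has_sum E f s -> 0 <= s.
Proof.
move=> f0 hs.
have app (e : R) : 0 < e -> exists2 t : R[i], 0 <= t & `|t - s| < e%:C.
  move=> e0; have [|F FE /(_ F (fsubset_refl _) FE) h] := hs e%:C; first by rewrite ltcR.
  exists (\sum_(i <- F) f i) => //; rewrite big_seq sumr_ge0 // => i iF.
  by apply: f0; exact: FE.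
have rle (z : R[i]) : `|complex.Re z|%:C <= `|z| by exact: normc_ge_Re.
have ile (z : R[i]) : `|complex.Im z|%:C <= `|z|.
  have := normc_ge_Re (z * 'i); rewrite ReiNIm normrN normrM.
  by rewrite normc_i mulr1.
rewrite lecE; apply/andP; split => /=.
  rewrite -normr_le0; apply/ler_addgt0Pl => e e0; rewrite addr0.
  have [t t0 ts] := app e e0; rewrite -lecR; apply/ltW/(le_lt_trans _ ts).
  apply: le_trans _ (ile _); rewrite raddfB /= (ger0_Im t0) sub0r normrN //.
rewrite -oppr_le0; apply/ler_addgt0Pl => e e0; rewrite addr0.
have [t t0 ts] := app e e0; move: t0; rewrite lecE /= => /andP[_ t0].
have := le_lt_trans (rle _) ts; rewrite ltcR raddfB /= => h.
by have := ler_norm (complex.Re t - complex.Re s); lra.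
Qed.

Lemma has_sum_image E f s (g g' : I -> I) : cancel g g' -> cancel g' g ->
  has_sum (g @` E) f s -> has_sum E (fun x => f (g x)) s.
Proof.
move=> gK g'K hs e e0; have [F FE hF] := hs e e0.
exists [fset g' y | y in F]%fset.
  by move=> _ /= /imfsetP[y /= /FE[x Ex <-] ->]; rewrite gK.
move=> G FG GE; have := hF [fset g x | x in G]%fset.
rewrite big_imfset /=; last by move=> x y _ _; exact: can_inj gK _ _.
apply.
  apply/fsubsetP => y yF; apply/imfsetP; exists (g' y); last by rewrite g'K.
  by apply: (fsubsetP FG); apply/imfsetP; exists y.
by move=> _ /= /imfsetP[x /= /GE Ex ->]; exists x.
Qed.

End UnorderedSums.

(** * Density states: linearity, positivity, variances *)

Section States.
Context {R : realType} {H : hilbertType R[i]}.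
Implicit Types (T U D Q X Y : H -> H).
Variables (omega : (H -> H) -> R[i]) (homega : density_state omega).

Lemma stateD T U : bounded_op T -> bounded_op U ->
  omega (fun x => T x + U x) = omega T + omega U.
Proof.
move=> bT bU; have [rho [brho _ _] hrho] := homega.
have [lrho _] := bounded_opE brho; have [E hE] := orthonormal_basis_exists H.
apply: has_sum_unique (hrho _ (bounded_opD bT bU) E hE) _.
have := has_sumD (hrho _ bT E hE) (hrho _ bU E hE).
congr has_sum; apply/funext => x /=; by rewrite (linear_D lrho) linearDl.
Qed.

Lemma stateZ (k : R[i]) T : bounded_op T -> omega (fun x => k *: T x) = k * omega T.
Proof.
move=> bT; have [rho [brho _ _] hrho] := homega.
have [lrho _] := bounded_opE brho; have [E hE] := orthonormal_basis_exists H.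
apply: has_sum_unique (hrho _ (bounded_opZ k bT) E hE) _.
have := has_sumZ k (hrho _ bT E hE).
congr has_sum; apply/funext => x /=; by rewrite (linear_Z lrho) linearZl_LR.
Qed.

Lemma state1 : omega idfun = 1.
Proof.
have [rho [brho _ trho] hrho] := homega; have [E hE] := orthonormal_basis_exists H.
exact: has_sum_unique (hrho _ bounded_op_id E hE) (trho E hE).
Qed.

Lemma stateB T U : bounded_op T -> bounded_op U ->
  omega (fun x => T x - U x) = omega T - omega U.
Proof.
move=> bT bU; rewrite -mulN1r -stateZ // -stateD //; last exact: bounded_opZ.
by congr omega; apply/funext => x; rewrite scaleN1r.
Qed.

Lemma orthonormal_basis_image (U V : H -> H) (E : set H) : cancel U V -> cancel V U ->
  linear U -> (forall x y, inner (U x) y = inner x (V y)) ->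
  orthonormal_basis E -> orthonormal_basis (U @` E).
Proof.
move=> UV VU lU adj [hE tE]; split.
  move=> _ _ [x Ex <-] [y Ey <-]; rewrite adj UV hE //.
  by rewrite (inj_eq (can_inj UV)).
move=> x hx; have : V x = 0.
  apply: tE => y Ey; have := hx (U y) (ex_intro2 _ _ y Ey erefl).
  by rewrite innerC adj -innerC.
by move=> h; rewrite -(VU x) h (linear_0 lU).
Qed.

Lemma state_sqr_ge0 (c d : H -> H) : bounded_op c -> bounded_op d ->
  self_adjoint c -> self_adjoint d -> (forall x, c (d x) = d (c x)) ->
  (forall x, c (c x) + d (d x) = x) -> 0 <= omega (fun x => c (c x)).
Proof.
move=> bc bd sc sd cd cd1; have [lc _] := bounded_opE bc; have [ld _] := bounded_opE bd.
have [rho [brho prho _] hrho] := homega; have [lrho _] := bounded_opE brho.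
pose U x := c x + 'i *: d x; pose V x := c x + (- 'i) *: d x.
have bU : bounded_op U := bounded_opD bc (bounded_opZ _ bd).
have bV : bounded_op V := bounded_opD bc (bounded_opZ _ bd).
have UV : cancel U V.
  move=> x; rewrite /U /V (linear_D lc) (linear_D ld) (linear_Z lc) (linear_Z ld).
  rewrite scalerDr scalerA mulNr -expr2 sqr_i opprK scale1r.
  by rewrite [X in _ + X]addrC addrACA scaleNr cd subrr addr0 cd1.
have VU : cancel V U.
  move=> x; rewrite /U /V (linear_D lc) (linear_D ld) (linear_Z lc) (linear_Z ld).
  rewrite scalerDr scalerA mulrN -expr2 sqr_i opprK scale1r.
  by rewrite [X in _ + X]addrC addrACA scaleNr cd addNr addr0 cd1.
have UVadj x y : inner (U x) y = inner x (V y).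
  rewrite /U /V linearDl linearDr /= linearZl_LR linearZr_LR /= sc sd; congr (_ + _ * _).
  by apply/eqP; rewrite eq_complex /= ?oppr0 ?opprK !eqxx.
have VUadj x y : inner (V x) y = inner x (U y).
  rewrite /U /V linearDl linearDr /= linearZl_LR linearZr_LR /= sc sd; congr (_ + _ * _).
  by apply/eqP; rewrite eq_complex /= ?oppr0 ?opprK !eqxx.
have [E hE] := orthonormal_basis_exists H.
have hEU := orthonormal_basis_image UV VU bU.1 UVadj hE.
have hEV := orthonormal_basis_image VU UV bV.1 VUadj hE.
(* At V x the term of c U is <rho (c x), V x>, and at U x the term of c V is <rho (c x), U x>. Their
   sum pairs rho (c x) with V x + U x = 2 c x, while c U + c V = 2 c^2. *)
have hU := has_sum_image VU UV (hrho _ (bounded_opM bc bU) _ hEV).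
have hV := has_sum_image UV VU (hrho _ (bounded_opM bc bV) _ hEU).
have := has_sum_ge0 _ (has_sumD hU hV).
rewrite -stateD; [|exact: bounded_opM|exact: bounded_opM].
have -> : (fun x => c (U x) + c (V x)) = (fun x => 2%:C *: c (c x)).
  apply/funext => x; rewrite -(linear_D lc) -(linear_Z lc); congr c.
  by rewrite /U /V scaleNr addrACA subrr addr0 rmorphD rmorph1 scalerDl scale1r.
rewrite stateZ; last exact: bounded_opM.
rewrite pmulr_rge0 ?ltcR //; apply=> x Ex /=; rewrite VU UV -linearDr /=.
have -> : V x + U x = 2%:C *: c x.
  by rewrite /U /V scaleNr addrACA addNr addr0 rmorphD rmorph1 scalerDl scale1r.
by rewrite linearZr_LR /= conjR mulr_ge0 ?ler0c.
Qed.

(* After scaling, both Q and 1 - Q have square roots given by a norm convergent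
   iteration. *)
Lemma state_ge0_strict Q (e : R) : bounded_op Q -> self_adjoint Q -> 0 < e ->
  (forall x, e * rip x x <= rip (Q x) x) -> 0 <= omega Q.
Proof.
move=> bQ sQ e0 hQ; have [lQ [L0 L00 hL0]] := bounded_opE bQ.
pose L : R := L0 + e; have Lp : 0 < L by rewrite /L; lra.
have hL x : nrm (Q x) <= L * nrm x.
  by apply: le_trans (hL0 x) _; rewrite ler_wpM2r ?nrm_ge0 // /L; lra.
(* With q = k Q, this choice gives |q x|^2 <= (k e / 2) |x|^2, so |x - q x|^2 <= (1 - 2 k e + k e /
   2) |x|^2, which is below (1 - k e / 2)^2 |x|^2. The strict lower bound [e] on [Q] is what keeps
   the ratio [r] below 1. *)
have [k k0 kL2] : exists2 k : R, 0 < k & k * L ^+ 2 = e / 2.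
  exists (e / (2 * L ^+ 2)); first by rewrite divr_gt0 // mulr_gt0 ?exprn_gt0.
  by field; rewrite gt_eqF.
have eL : e <= L by rewrite /L; lra.
have kL : k * L <= 1 / 2.
  rewrite -(ler_pM2r Lp) -mulrA -expr2 kL2; lra.
have ke : k * e <= 1 / 2 by apply: le_trans kL; rewrite ler_pM2l.
pose q x := k%:C *: Q x; have bq : bounded_op q by exact: bounded_opZ.
have [lq _] := bounded_opE bq.
have qsym x y : rip (q x) y = rip x (q y).
  by rewrite /q ripZl ripZr (self_adjoint_rip sQ).
have qr x : nrm (q x) <= 1 / 2 * nrm x.
  rewrite /q nrmZ ger0_norm ?(ltW k0) //; apply: le_trans (ler_wpM2l (ltW k0) (hL x)) _.
  by rewrite mulrA ler_wpM2r ?nrm_ge0.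
pose p x := x - q x; have bp : bounded_op p by exact: bounded_opB bounded_op_id bq.
have [lp _] := bounded_opE bp.
have psym x y : rip (p x) y = rip x (p y) by rewrite /p ripBl ripBr qsym.
pose r : R := 1 - k * e / 2; have ke0 : 0 < k * e by rewrite mulr_gt0.
have pr x : nrm (p x) <= r * nrm x.
  rewrite -(@ler_pXn2r _ 2) ?nnegrE ?nrm_ge0 ?mulr_ge0 ?nrm_ge0 //; last by rewrite /r; lra.
  rewrite -rip_nrm /p ripBl !ripBr !rip_nrm (ripC x (q x)) exprMn.
  have h1 : nrm (q x) ^+ 2 <= k * e / 2 * nrm x ^+ 2.
    rewrite /q nrmZ ger0_norm ?(ltW k0) // exprMn.
    have -> : k * e / 2 * nrm x ^+ 2 = k ^+ 2 * (L * nrm x) ^+ 2.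
      have -> : k * e / 2 = k ^+ 2 * L ^+ 2 by rewrite -mulrA -kL2 mulrA expr2.
      by rewrite exprMn -mulrA.
    by rewrite ler_wpM2l ?sqr_ge0 // ler_pXn2r ?nnegrE ?mulr_ge0 ?nrm_ge0 ?(ltW Lp).
  have h2 : k * e * nrm x ^+ 2 <= rip (q x) x.
    by rewrite /q ripZl -mulrA ler_pM2l // -rip_nrm.
  have h3 : 1 - k * e <= r ^+ 2 by rewrite /r; have := sqr_ge0 (k * e); nra.
  have := mulr_ge0 (ltW ke0) (sqr_ge0 (nrm x)); have := ler_wpM2r (sqr_ge0 (nrm x)) h3; lra.
have r0 : 0 <= r by rewrite /r; lra.
have r1 : r < 1 by rewrite /r; lra.
(* The root of 1 - p is a root of q, and [d] below is a root of 1 - q; hence c^2 + d^2 = 1 and c + i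
   d is unitary. *)
have [c [lc sc hc cc ccomm]] := op_sqrt lp psym pr r0 r1.
have half0 : 0 <= 1 / 2 :> R by lra.
have half1 : 1 / 2 < 1 :> R by lra.
have [d [ld sd hd dd dcomm]] := op_sqrt lq qsym qr half0 half1.
have bc : bounded_op c by exact: bounded_op_real hc.
have bd : bounded_op d by exact: bounded_op_real hd.
have cp x : p (c x) = c (p x) by exact: ccomm.
have cq x : c (q x) = q (c x).
  have qp y : q y = y - p y by rewrite /p subKr.
  by rewrite !qp (linear_B lc) cp.
have := @state_sqr_ge0 c d bc bd sc sd (dcomm c bc cq).
have -> : (fun x => c (c x)) = q by apply/funext => x; rewrite cc /p subKr.
rewrite /q stateZ // pmulr_rge0 ?ltcR //; apply => x.
by rewrite cc dd /p subKr addrC subrK.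
Qed.

Lemma state_ge0 Q : bounded_op Q -> self_adjoint Q -> (forall x, 0 <= rip (Q x) x) ->
  0 <= omega Q.
Proof.
move=> bQ sQ hQ.
have key (e : R) : 0 < e -> 0 <= omega Q + e%:C.
  move=> e0; have be := bounded_opZ e%:C (@bounded_op_id _ H).
  rewrite -[X in _ + X]mulr1 -state1 -stateZ; last exact: bounded_op_id.
  rewrite -stateD //; apply: (state_ge0_strict _ _ e0); first exact: bounded_opD.
    move=> x y; have := self_adjointB (- e) sQ x y.
    by rewrite rmorphN !scaleNr !opprK.
  by move=> x; rewrite ripDl ripZl lerDr.
rewrite lecE /=; apply/andP; split.
  by have := key 1 ltr01; rewrite lecE raddfD /= addr0 => /andP[].
rewrite -oppr_le0; apply/ler_addgt0Pl => e /key; rewrite lecE !raddfD /= => /andP[_ h].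
lra.
Qed.

Lemma state_real T : bounded_op T -> self_adjoint T -> (complex.Re (omega T))%:C = omega T.
Proof.
move=> bT sT; have [lT [c c0 hc]] := bounded_opE bT.
have bc := bounded_opZ c%:C (@bounded_op_id _ H).
have : 0 <= omega (fun x => T x + c%:C *: idfun x).
  apply: state_ge0; first exact: bounded_opD.
    move=> x y; have := self_adjointB (- c) sT x y.
    by rewrite rmorphN !scaleNr !opprK.
  move=> x; rewrite ripDl ripZl rip_nrm; have := Cauchy_Schwarz (T x) x.
  by rewrite ler_norml => /andP[h _]; have := hc x; have := nrm_ge0 x; nra.
rewrite stateD // stateZ; last exact: bounded_op_id.
rewrite state1 mulr1 lecE raddfD /= addr0 => /andP[/eqP h _].
by case: (omega T) h => a b /= ->.
Qed.

(** Squaring the hypothesis with (p + q)^2 <= 2 p^2 + 2 q^2 gives the operator inequality X^2 <= 2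
    c^2 Y^2 + 2 e^2, to which positivity of the state applies. *)
Lemma state_le_of_nrm X Y (c e : R) : bounded_op X -> bounded_op Y ->
  self_adjoint X -> self_adjoint Y -> 0 <= c -> 0 <= e ->
  (forall x, nrm (X x) <= c * nrm (Y x) + e * nrm x) ->
  complex.Re (omega (fun x => X (X x))) <=
    2 * c ^+ 2 * complex.Re (omega (fun x => Y (Y x))) + 2 * e ^+ 2.
Proof.
move=> bX bY sX sY c0 e0 h; set k1 := 2 * c ^+ 2; set k2 := 2 * e ^+ 2.
have bXX := bounded_opM bX bX; have bYY := bounded_opM bY bY.
have b1 := bounded_opZ k1%:C bYY; have b2 := bounded_opZ k2%:C (@bounded_op_id _ H).
have b12 := bounded_opD b1 b2.
have := @state_ge0 (fun x => (k1%:C *: Y (Y x) + k2%:C *: x) - X (X x)).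
rewrite stateB // stateD // !stateZ //; last exact: bounded_op_id.
rewrite state1 mulr1 => key.
have : 0 <= k1%:C * omega (fun x => Y (Y x)) + k2%:C - omega (fun x => X (X x)).
  apply: key; first exact: bounded_opB.
    move=> x y; rewrite !linearBl !linearBr /= !linearDl !linearDr /=.
    by rewrite !linearZl_LR !linearZr_LR /= !conjR !sY !sX.
  move=> x; rewrite ripBl ripDl !ripZl.
  rewrite (self_adjoint_rip sX) (self_adjoint_rip sY) !rip_nrm.
  have h2 : nrm (X x) ^+ 2 <= (c * nrm (Y x) + e * nrm x) ^+ 2.
    by rewrite ler_pXn2r ?nnegrE ?nrm_ge0 ?addr_ge0 ?mulr_ge0 ?nrm_ge0.
  have := sqr_ge0 (c * nrm (Y x) - e * nrm x); rewrite /k1 /k2; nra.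
rewrite lecE !raddfB !raddfD /= => /andP[_].
by case: (omega (fun x => Y (Y x))) => u v /=; lra.
Qed.

Definition shift T (m : R) : H -> H := fun x => T x - m%:C *: x.

Lemma bounded_op_shift T m : bounded_op T -> bounded_op (shift T m).
Proof. by move=> bT; apply: bounded_opB => //; exact: bounded_opZ bounded_op_id. Qed.

Lemma Delta_sqr T (m := complex.Re (omega T)) : bounded_op T -> self_adjoint T ->
  Delta omega T ^+ 2 = complex.Re (omega (fun x => shift T m (shift T m x))).
Proof.
move=> bT sT; have bT0 := bounded_op_shift m bT.
have sT0 : self_adjoint (shift T m) by exact: self_adjointB.
rewrite /Delta -(state_real bT sT) -/m sqr_sqrtr //.
have : 0 <= omega (fun x => shift T m (shift T m x)); last by rewrite lecE => /andP[].
apply: state_ge0; first exact: bounded_opM.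
  by move=> x y; rewrite !sT0.
by move=> x; rewrite (self_adjoint_rip sT0) rip_ge0.
Qed.

(** The second moment about [t] exceeds the variance by (m - t)^2. This allows [t] to be any number
    rather than the mean of [T]. *)
Lemma Delta_sqr_le T (t : R) : bounded_op T -> self_adjoint T ->
  Delta omega T ^+ 2 <= complex.Re (omega (fun x => shift T t (shift T t x))).
Proof.
move=> bT sT; rewrite Delta_sqr //; set m := complex.Re (omega T).
have bid := @bounded_op_id R H; have bm := bounded_opZ m%:C bid.
have bT0 := bounded_op_shift m bT; have [lT _] := bounded_opE bT.
have b1 := bounded_opZ (2 * (m - t))%:C bT0; have b2 := bounded_opZ ((m - t) ^+ 2)%:C bid.
have bTT := bounded_opM bT0 bT0.
have -> : (fun x => shift T t (shift T t x)) =
    (fun x => (shift T m (shift T m x) + (2 * (m - t))%:C *: shift T m x)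
    + ((m - t) ^+ 2)%:C *: idfun x).
  apply/funext => x; rewrite /shift !(linear_B lT) !(linear_Z lT).
  by apply: rip_eq => z; rewrite !(ripDl, ripNl, ripZl); ring.
have h0 : omega (shift T m) = 0.
  by rewrite stateB // stateZ // state1 mulr1 -(state_real bT sT) subrr.
rewrite stateD //; last exact: bounded_opD.
rewrite stateD // !stateZ // h0 mulr0 addr0 state1 mulr1.
by rewrite raddfD /= lerDl sqr_ge0.
Qed.

Lemma Delta_le T D (c e : R) : bounded_op T -> bounded_op D -> self_adjoint T ->
  self_adjoint D -> 0 <= c -> 0 <= e ->
  (forall d : R, exists t : R, forall x,
     nrm (T x - t%:C *: x) <= c * nrm (D x - d%:C *: x) + e * nrm x) ->
  Delta omega T ^+ 2 <= 2 * c ^+ 2 * Delta omega D ^+ 2 + 2 * e ^+ 2.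
Proof.
move=> bT bD sT sD c0 e0 h; have [t ht] := h (complex.Re (omega D)).
apply: le_trans (Delta_sqr_le t bT sT) _; rewrite (Delta_sqr bD sD).
by apply: state_le_of_nrm => //; do ?[exact: bounded_op_shift|exact: self_adjointB].
Qed.

End States.

(** * Complementarity excludes commutativity *)

Theorem proposition2p8 (R : realType) (A : cstarAlgType R[i])
    (H : hilbertType R[i]) (pi : A -> H -> H) (hpi : representation pi)
    (S : set ((H -> H) -> R[i])) (hS0 : S !=set0)
    (hS : forall omega, S omega -> density_state omega)
    (hexp : experimental_principle pi S)
    (a b : A) (ha : star a = a) (hb : star b = b)
    (hab : complementary S (pi a) (pi b)) :
  ~ commutative_ops (cstar_generated [set pi a; pi b; idfun]).
Proof.
set G := [set pi a; pi b; idfun] => hcomm.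
have GR : G `<=` range pi.
  move=> T [[->|->]|->]; [by exists a|by exists b|exists 1 => //].
  exact: (representation1 hpi).
have [hB GB BR] := cstar_generated_min (range_cstar_subalgebra hpi) GR.
set B := cstar_generated G in hcomm hB GB BR.
(* Adjoints come from the inclusion of [B] in the range: an element [pi c] has the adjoint
   [pi (star c)]. *)
have Badj T : B T -> exists2 U, B U & is_adjoint T U.
  move=> BT; have [c _ cT] := BR _ BT; have adj : is_adjoint T (pi (star c)).
    by rewrite -cT; exact: (representation_star hpi).
  by exists (pi (star c)) => //; exact: (cstar_subalgebra_adj hB BT adj).
have Mra := von_neumann_sa_algebra hcomm (cstar_subalgebra_id hB) (@cstar_subalgebraD _ _ _ hB)
  (@cstar_subalgebraZ _ _ _ hB) (@cstar_subalgebraM _ _ _ hB) Badj.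
have sa c : star c = c -> self_adjoint (pi c).
  by move=> sc; have := representation_star hpi c; rewrite sc.
have M_of c : star c = c -> B (pi c) -> von_neumann_sa B (pi c).
  move=> sc Bc; split; [exact: representation_bounded|exact: sa|exact: wo_closure_sub].
have Ma : von_neumann_sa B (pi a) by apply: M_of => //; apply: GB; left; left.
have Mb : von_neumann_sa B (pi b) by apply: M_of => //; apply: GB; left; right.
have [[ba sa_a _] [bb sa_b _]] := (Ma, Mb).
have [C C0 hC] := hab.
have na := representation_nonexpansive hpi a; have nb := representation_nonexpansive hpi b.
have La z : nrm (pi a z) <= (an a + an b) * nrm z.
  by apply: le_trans (na z) _; rewrite ler_wpM2r ?nrm_ge0 // lerDl an_ge0.
have Lb z : nrm (pi b z) <= (an a + an b) * nrm z.
  by apply: le_trans (nb z) _; rewrite ler_wpM2r ?nrm_ge0 // lerDr an_ge0.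
(* The approximation error and c times the spread of [D] are each kept within C / 4; then 2 (C/4)^2
   + 2 (C/4)^2 = (C/2)^2 puts both spreads below C / 2. *)
have e0 : 0 < C / 4 by lra.
have [D [MD D1 [c c0 hctrl]]] := joint_control Mra Ma Mb La Lb e0.
have [bD sD wD] := MD.
have obs : observable pi D by split=> //; exists B.
pose delta : R := C / (4 * (c + 1)).
have c1 : 0 < c + 1 by lra.
have d0 : 0 < delta by rewrite divr_gt0 // mulr_gt0.
(* [inf] is 0 by default on a set without infimum, so a state with spread below [delta] is obtained
   from the nonemptiness of [S] and the lower bound 0. *)
have [_ [omega Somega <-] small] : exists2 r, [set Delta omega D | omega in S] r & r < delta.
  rewrite -[delta]add0r -(hexp D obs); apply: inf_adherent => //; split.
    by have [w Sw] := hS0; exists (Delta w D), w.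
  by exists 0 => _ [w _ <-]; rewrite /Delta sqrtr_ge0.
have hw := hS _ Somega.
have bound T : bounded_op T -> self_adjoint T -> (forall d : R, exists t : R, forall x,
     nrm (T x - t%:C *: x) <= c * nrm (D x - d%:C *: x) + C / 4 * nrm x) ->
    Delta omega T < C / 2.
  move=> bT sT h; have := Delta_le hw bT bD sT sD c0 (ltW e0) h.
  have D0 : 0 <= Delta omega D by rewrite /Delta sqrtr_ge0.
  have D2 : c * Delta omega D < C / 4.
    have : (c + 1) * Delta omega D < C / 4.
      have -> : C / 4 = (c + 1) * delta by rewrite /delta; field; rewrite gt_eqF.
      by rewrite ltr_pM2l.
    lra.
  have D3 : (c * Delta omega D) ^+ 2 < (C / 4) ^+ 2.
    by rewrite ltr_pXn2r // nnegrE; [exact: mulr_ge0|exact: ltW].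
  move=> h2; rewrite -(@ltr_pXn2r _ 2) ?nnegrE ?sqrtr_ge0 //; last by lra.
  apply: le_lt_trans h2 _; rewrite exprMn in D3; move: D3; rewrite !expr2; lra.
have := hC _ Somega; apply/negP; rewrite -ltNge.
have := bound _ ba sa_a (fun d => (hctrl d).1).
have := bound _ bb sa_b (fun d => (hctrl d).2); lra.
Qed.
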